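(* Let $A,B\in\mathcal{P}_n$, $K\in\mathcal{M}_n$, and $p,q,s\in\mathbb{R}$. Put $$\Psi_{p,q,s}(A,B)=\mathrm{Tr}\left(B^{\frac q2}K^*A^pKB^{\frac q2}\right)^s.$$ (i) If $s,q>0$ and $s<1/q$, then $$\Psi_{p,q,s}(A,B)=\min_{Z>0}\left\{\left(\mathrm{Tr}\,(Z^{-\frac12}K^*A^pKZ^{-\frac12})^{\frac{s}{1-sq}}\right)^{1-sq}\cdot\left(\mathrm{Tr}\,(Z^{\frac12}B^qZ^{\frac12})^{\frac1q}\right)^{sq}\right\}$$ and $$\Psi_{p,q,s}(A,B)=\min_{Z>0}\left\{(1-sq)\,\mathrm{Tr}\,(Z^{-\frac12}K^*A^pKZ^{-\frac12})^{\frac{s}{1-sq}}+sq\,\mathrm{Tr}\,(Z^{\frac12}B^qZ^{\frac12})^{\frac1q}\right\}.$$ (ii) If $s>0$ and $q<0$, then $$\Psi_{p,q,s}(A,B)=\max_{Z>0}\left\{\left(\mathrm{Tr}\,(Z^{-\frac12}K^*A^pKZ^{-\frac12})^{\frac{s}{1-sq}}\right)^{1-sq}\cdot\left(\mathrm{Tr}\,(Z^{\frac12}B^qZ^{\frac12})^{\frac1q}\right)^{sq}\right\}$$ and $$\Psi_{p,q,s}(A,B)=\max_{Z>0}\left\{(1-sq)\,\mathrm{Tr}\,(Z^{-\frac12}K^*A^pKZ^{-\frac12})^{\frac{s}{1-sq}}+sq\,\mathrm{Tr}\,(Z^{\frac12}B^qZ^{\frac12})^{\frac1q}\right\}.$$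
   Context: $\mathcal{M}_n$ is the set of $n\times n$ matrices and $\mathcal{P}_n$ the set of $n\times n$ positive definite matrices; $Z>0$ means $Z\in\mathcal{P}_n$. Powers of positive (semi)definite matrices are taken by functional calculus; $\mathrm{Tr}\,X^s$ means $\mathrm{Tr}(X^s)$.
   Formalization: For singular K the min/max need not be attained (n=1, K=0, sum formula: Psi=0 but all values are nonzero); so inf (i) / sup (ii) is stated for every K, and attained min/max only for K invertible or, in the product formulas, also K=0. *)

(* Defs.v *)
From HB Require Import structures.
From mathcomp Require Import all_boot all_order all_algebra.
From mathcomp Require Import complex.
From mathcomp Require Import boolp classical_sets reals exp.

Set Implicit Arguments.
Unset Strict Implicit.
Unset Printing Implicit Defensive.

Import Order.TTheory GRing.Theory Num.Theory.

Local Open Scope ring_scope.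
Local Open Scope complex_scope.
Local Open Scope sesquilinear_scope.

(* The order on R[i] is partial: 0 < z forces z to be real. Vectors are rows. *)
Definition posdefmx (R : realType) (n : nat) (Z : 'M[R[i]]_n) : Prop :=
  Z \is hermsymmx /\
  forall v : 'rV[R[i]]_n, v != 0 -> 0 < (v *m Z *m v^t*) 0 0.

(* Functional calculus for Hermitian X: X = P^-1 diag(d) P, with P unitary and
   d real, is sent to P^-1 diag(f d) P. Meaningless when X is not Hermitian. *)
Definition mxfun (R : realType) (n : nat) (f : R -> R) (X : 'M[R[i]]_n) :
    'M[R[i]]_n :=
  invmx (spectralmx X)
    *m diag_mx (map_mx (fun z : R[i] => (f (complex.Re z))%:C) (spectral_diag X))
    *m spectralmx X.

(* For X positive definite and r real, or X positive semidefinite and r > 0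
   (powR satisfies 0 `^ r = 0 for r != 0). *)
Definition mxpowR (R : realType) (n : nat) (X : 'M[R[i]]_n) (r : R) :
    'M[R[i]]_n :=
  mxfun (fun x : R => x `^ r) X.

(* Tr (X ^ r), which is a real number for Hermitian X. *)
Definition trpowR (R : realType) (n : nat) (X : 'M[R[i]]_n) (r : R) : R :=
  complex.Re (\tr (mxpowR X r)).

Definition Psi (R : realType) (n : nat) (K : 'M[R[i]]_n) (p q s : R)
    (A B : 'M[R[i]]_n) : R :=
  trpowR (mxpowR B (q / 2) *m K^t* *m mxpowR A p *m K *m mxpowR B (q / 2)) s.

Definition trace_left (R : realType) (n : nat) (K : 'M[R[i]]_n) (p q s : R)
    (A Z : 'M[R[i]]_n) : R :=
  trpowR (mxpowR Z (- (1 / 2)) *m K^t* *m mxpowR A p *m K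
            *m mxpowR Z (- (1 / 2))) (s / (1 - s * q)).

Definition trace_right (R : realType) (n : nat) (q : R)
    (B Z : 'M[R[i]]_n) : R :=
  trpowR (mxpowR Z (1 / 2) *m mxpowR B q *m mxpowR Z (1 / 2)) (1 / q).

Definition product_values (R : realType) (n : nat) (K : 'M[R[i]]_n) (p q s : R)
    (A B : 'M[R[i]]_n) : set R :=
  [set x | exists2 Z : 'M[R[i]]_n, posdefmx Z &
     x = trace_left K p q s A Z `^ (1 - s * q)
         * trace_right q B Z `^ (s * q)].

Definition sum_values (R : realType) (n : nat) (K : 'M[R[i]]_n) (p q s : R)
    (A B : 'M[R[i]]_n) : set R :=
  [set x | exists2 Z : 'M[R[i]]_n, posdefmx Z &
     x = (1 - s * q) * trace_left K p q s A Z + s * q * trace_right q B Z].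

Definition is_min (R : realType) (E : set R) (m : R) : Prop :=
  E m /\ lbound E m.

Definition is_max (R : realType) (E : set R) (m : R) : Prop :=
  E m /\ ubound E m.

(* Main.v *)
(* Write [X = K^* A^p K] and [Y = B^q]. Since traces of powers only depend on
   characteristic polynomials, [Psi] is the trace of [(X Y)^s], and the two
   factors are the traces of [(X Z^-1)^(s/(1-sq))] and [(Z Y)^(1/q)]. Choose
   [F] with [Y = F F^*] and [F^* X F = diag d]; then [P = F^* Z F] is positive
   definite and the three spectra are those of [diag d], [diag d P^-1] and [P].

   For [q > 0] the lower bound is Hoelder's inequality for traces. Let
   [P = L L^*] be a Cholesky decomposition and [l_i = |L_ii|^2]. Weyl's majorant
   theorem gives [sum_i l_i^t <= Tr P^t] and, applied to [L^-1], also
   [sum_i (d_i/l_i)^r <= Tr (diag d P^-1)^r], for all positive [r] and [t].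
   Since [d_i = (d_i/l_i) l_i], the scalar Hoelder inequality concludes. For
   [q < 0], the same inequality for the triple [X], [Z^-1], [Y^-1] is the upper
   bound. Young's inequality, or its reverse, relates the products to the sums.

   With [P = diag d^(sq)] all bounds are equalities; if some [d_i] vanish, the
   corresponding entries of [P] are set to a constant making their contribution
   to the sum arbitrarily small. *)

Require Import Defs.
From HB Require Import structures.
From mathcomp Require Import all_boot all_order all_algebra.
From mathcomp Require Import complex.
From mathcomp Require Import boolp classical_sets reals exp.
From mathcomp Require Import topology normedtype sequences.
From mathcomp Require Import ring lra.

Set Implicit Arguments.
Unset Strict Implicit.
Unset Printing Implicit Defensive.

Import Order.TTheory GRing.Theory Num.Theory.
Import numFieldNormedType.Exports.

Local Open Scope ring_scope.
Local Open Scope complex_scope.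
Local Open Scope sesquilinear_scope.

(** * Scalar inequalities *)

Section ScalarInequalities.
Variable R : realType.
Implicit Types a x y p w : R.

(** Put x = e^u and use e^v >= 1 + v at v = u (1 - a) and at v = - u a. *)
Lemma powR_le_tangent a x : 0 < a <= 1 -> 0 <= x -> x `^ a <= 1 + a * (x - 1).
Proof.
move=> /andP[a0 a1]; rewrite le_eqVlt => /predU1P[<-|x0].
  by rewrite powR0 ?gt_eqF//; lra.
rewrite -[x](@lnK _ x) ?posrE// -expRM; set u := ln x.
have e0 : 0 < expR (u * a) by exact: expR_gt0.
have h1 : expR (u * a) * (1 + u * (1 - a)) <= expR u.
  have -> : expR u = expR (u * a) * expR (u * (1 - a)).
    by rewrite -expRD; congr expR; ring.
  by rewrite ler_pM2l// expR_ge1Dx.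
have h2 : expR (u * a) * (1 - u * a) <= 1.
  by rewrite -[leRHS](expRxMexpNx_1 (u * a)) ler_pM2l// expR_ge1Dx.
(* With the weights [a] and [1 - a] the terms linear in [u] cancel. *)
have := lerD (ler_wpM2l (ltW a0) h1) (ler_wpM2l (_ : 0 <= 1 - a) h2).
by rewrite subr_ge0 => /(_ a1); lra.
Qed.

(** The concave inequality for the exponent [a^-1], taken at the point x^a. *)
Lemma powR_ge_tangent a x : 1 <= a -> 0 <= x -> 1 + a * (x - 1) <= x `^ a.
Proof.
move=> a1 x0; have a0 : 0 < a by lra.
have a01 : 0 < a^-1 <= 1 by rewrite invr_gt0 a0 invf_le1.
have := powR_le_tangent a01 (powR_ge0 x a).
rewrite -powRrM divff ?gt_eqF// powRr1//.
rewrite -(ler_pM2l a0) mulrDr mulrA divff ?gt_eqF//; lra.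
Qed.

(* The tangent inequality at [x / y], scaled by [y]. *)
Lemma young_powR a x y : 0 < a < 1 -> 0 <= x -> 0 <= y ->
  x `^ (1 - a) * y `^ a <= (1 - a) * x + a * y.
Proof.
move=> /andP[a0 a1] x0; rewrite le_eqVlt => /predU1P[<-|y0].
  by rewrite powR0 ?gt_eqF// !mulr0 addr0 mulr_ge0//; lra.
have h := @powR_le_tangent (1 - a) (x / y) _ (divr_ge0 x0 (ltW y0)).
have {h}/h : 0 < 1 - a <= 1 by lra.
rewrite -(ler_pM2l y0) => h.
have -> : x `^ (1 - a) * y `^ a = y * (x / y) `^ (1 - a).
  rewrite powRM// ?invr_ge0 ?ltW// -powR_inv1 ?ltW// -powRrM mulrCA; congr (_ * _).
  rewrite -{2}(powRr1 (ltW y0)) -powRD ?(gt_eqF y0) ?implybT//.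
  by congr (_ `^ _); ring.
apply: (le_trans h); rewrite le_eqVlt; apply/orP; left; apply/eqP.
by field; rewrite gt_eqF.
Qed.

(** The convex tangent inequality for the exponent [1 - a], again scaled by [y]. For [y = 0] the
    convention that 0 to a nonzero power is 0 makes the right side vanish, hence the condition on
    [x]. *)
Lemma young_powR_reverse a x y : a < 0 -> 0 <= x -> 0 <= y ->
  (y = 0 -> x = 0) -> (1 - a) * x + a * y <= x `^ (1 - a) * y `^ a.
Proof.
move=> a0 x0; rewrite le_eqVlt => /predU1P[<- /(_ erefl)->|y0 _].
  by rewrite !mulr0 addr0 mulr_ge0 ?powR_ge0.
have h := @powR_ge_tangent (1 - a) (x / y) _ (divr_ge0 x0 (ltW y0)).
have {h}/h : 1 <= 1 - a by lra.
rewrite -(ler_pM2l y0) => h.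
have -> : x `^ (1 - a) * y `^ a = y * (x / y) `^ (1 - a).
  rewrite powRM// ?invr_ge0 ?ltW// -powR_inv1 ?ltW// -powRrM mulrCA; congr (_ * _).
  rewrite -{2}(powRr1 (ltW y0)) -powRD ?(gt_eqF y0) ?implybT//.
  by congr (_ `^ _); ring.
apply: le_trans h; rewrite le_eqVlt; apply/orP; left; apply/eqP.
by field; rewrite gt_eqF.
Qed.

(** After both sums are normalised to 1, Young's inequality applies termwise. *)
Lemma holder_sum (I : finType) (x y : I -> R) a : 0 < a < 1 ->
  (forall i, 0 <= x i) -> (forall i, 0 <= y i) ->
  \sum_i x i `^ (1 - a) * y i `^ a
    <= (\sum_i x i) `^ (1 - a) * (\sum_i y i) `^ a.
Proof.
move=> a01 x0 y0; have /andP[a0 a1] := a01.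
have a1' : 1 - a != 0 by rewrite gt_eqF//; lra.
have sx0 : 0 <= \sum_i x i by exact: sumr_ge0.
have sy0 : 0 <= \sum_i y i by exact: sumr_ge0.
have [sx|sxn] := eqVneq (\sum_i x i) 0.
  rewrite big1 ?mulr_ge0 ?powR_ge0// => i _.
  by rewrite (psumr_eq0P _ sx)// powR0 ?mul0r.
have [sy|syn] := eqVneq (\sum_i y i) 0.
  rewrite big1 ?mulr_ge0 ?powR_ge0// => i _.
  by rewrite (psumr_eq0P _ sy)// powR0 ?mulr0 ?gt_eqF.
have sxp : 0 < \sum_i x i by rewrite lt_neqAle eq_sym sxn.
have syp : 0 < \sum_i y i by rewrite lt_neqAle eq_sym syn.
set X := \sum_i x i in sxp sxn *; set Y := \sum_i y i in syp syn *.
have XY0 : 0 < X `^ (1 - a) * Y `^ a by rewrite mulr_gt0 ?powR_gt0.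
suff : \sum_i (x i / X) `^ (1 - a) * (y i / Y) `^ a <= 1.
  rewrite -(ler_pM2l XY0) mulr1; apply: le_trans.
  rewrite mulr_sumr ler_sum// => i _.
  rewrite mulrACA -!powRM ?divr_ge0// ?(ltW sxp) ?(ltW syp)//.
  by rewrite !(mulrC X) !(mulrC Y) !divfK.
rewrite [leRHS](_ : _ = \sum_i ((1 - a) * (x i / X) + a * (y i / Y))); last first.
  by rewrite big_split/= -!mulr_sumr -!mulr_suml -/X -/Y !divff//; ring.
by apply: ler_sum => i _; apply: young_powR => //; rewrite divr_ge0.
Qed.

Lemma jensen_powR (I : finType) (c x : I -> R) p : 1 <= p ->
  (forall i, 0 <= c i) -> \sum_i c i = 1 -> (forall i, 0 <= x i) ->
  (\sum_i c i * x i) `^ p <= \sum_i c i * x i `^ p.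
Proof.
move=> p1 c0 c1 x0; set m := \sum_i c i * x i.
have m0 : 0 <= m by apply: sumr_ge0 => i _; rewrite mulr_ge0.
have [->|mn] := eqVneq m 0.
  by rewrite powR0 ?sumr_ge0// => [i _|]; rewrite ?mulr_ge0 ?powR_ge0// gt_eqF//; lra.
have mp : 0 < m by rewrite lt_neqAle eq_sym mn.
(* The tangent to t^p at the mean [m], averaged with the weights [c], returns m^p. *)
have -> : m `^ p = \sum_i c i * (m `^ p * (1 + p * (x i / m - 1))).
  transitivity (\sum_i (m `^ p * (1 - p) * c i + m `^ p * p / m * (c i * x i))).
    rewrite big_split/= -!mulr_sumr c1 -/m; field.
    by rewrite mn.
  by apply: eq_bigr => i _; field; rewrite mn.
apply: ler_sum => i _; apply: ler_wpM2l => //.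
have -> : x i `^ p = m `^ p * (x i / m) `^ p.
  by rewrite -powRM ?divr_ge0// mulrC divfK.
by rewrite ler_wpM2l ?powR_ge0// powR_ge_tangent// divr_ge0.
Qed.

End ScalarInequalities.

(** * Powers x^p from weighted sums of logarithms *)

Section LogarithmicMean.
Variables (R : realType) (w p : R).
Hypotheses (w1 : 1 < w) (p0 : 0 < p) (p1 : p < 1).
Implicit Types e x y : R.

Local Ltac lra_range := move: w1 p0 p1 => ? ? ?; lra.

(* The integral of [ln (1 + u x)] against [u `^ (- p - 1) du] over [u > 0] is a
   multiple of [x `^ p]. The sums below are its Riemann sums on the geometric
   grid of ratio [w]; scaling [x] by [w] shifts the grid. *)
Definition lattice_term e x : R := w `^ (- (p * e)) * ln (1 + w `^ e * x).

Definition lattice_sum (N : nat) x : R :=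
  \sum_(j < N.*2) lattice_term (j%:R - N%:R) x.

Lemma ratio_gt0 : 0 < w. Proof. exact: lt_trans w1. Qed.
Lemma ratio_neq0 : w != 0. Proof. by rewrite gt_eqF ?ratio_gt0. Qed.
Local Notation w0 := ratio_gt0.
Local Notation wn0 := ratio_neq0.

Lemma lattice_term_ge0 e x : 0 <= x -> 0 <= lattice_term e x.
Proof.
move=> x0; rewrite mulr_ge0 ?powR_ge0// ln_ge0// lerDl mulr_ge0 ?powR_ge0//.
Qed.

Lemma lattice_term_le e x y : 0 <= x -> x <= y ->
  lattice_term e x <= lattice_term e y.
Proof.
move=> x0 xy; have y0 := le_trans x0 xy.
rewrite ler_wpM2l ?powR_ge0// ler_ln ?posrE ?ltr_pwDl ?mulr_ge0 ?powR_ge0//.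
by rewrite lerD2l ler_wpM2l ?powR_ge0.
Qed.

Lemma lattice_term_shift e x :
  lattice_term e (w * x) = w `^ p * lattice_term (e + 1) x.
Proof.
rewrite /lattice_term [RHS]mulrA -powRD ?wn0 ?implybT//.
congr (_ `^ _ * ln (1 + _)); first by ring.
by rewrite powRD ?wn0 ?implybT// powRr1 ?(ltW w0)// mulrA.
Qed.

Lemma lattice_sum_le N x y : 0 <= x -> x <= y ->
  lattice_sum N x <= lattice_sum N y.
Proof. by move=> x0 xy; apply: ler_sum => j _; exact: lattice_term_le. Qed.

Lemma lattice_sumS N x : lattice_sum N.+1 x =
  lattice_term (- N.+1%:R) x + lattice_sum N x + lattice_term N%:R x.
Proof.
rewrite /lattice_sum doubleS big_ord_recl big_ord_recr /= addrA sub0r.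
congr (_ + _ + _); last first.
  by congr lattice_term; rewrite /bump/= add1n -addnn -!natr1 natrD; ring.
apply: eq_bigr => j _; congr lattice_term.
by rewrite /bump /= add1n -!natr1; ring.
Qed.

(** The shifted grid has the exponents 1 - N, ..., N; the larger sum adds the nonnegative terms at -
    N - 1 and - N. *)
Lemma lattice_sum_shift N x : 0 <= x ->
  lattice_sum N (w * x) <= w `^ p * lattice_sum N.+1 x.
Proof.
move=> x0; rewrite /lattice_sum mulr_sumr doubleS 2!big_ord_recl /=.
have t0 e : 0 <= w `^ p * lattice_term e x.
  by rewrite mulr_ge0 ?powR_ge0 ?lattice_term_ge0.
rewrite addrA ler_wpDl//; first exact: addr_ge0.
apply: ler_sum => j _; rewrite lattice_term_shift.
rewrite le_eqVlt; apply/orP; left; apply/eqP; congr (_ * lattice_term _ _).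
by rewrite /bump /= !add1n -!natr1; ring.
Qed.

(** Here the two surplus terms lie at the upper end of the larger grid. *)
Lemma lattice_sum_unshift N x : 0 <= x ->
  w `^ p * lattice_sum N x <= lattice_sum N.+1 (w * x).
Proof.
move=> x0; rewrite /lattice_sum mulr_sumr doubleS 2!big_ord_recr /=.
have t0 e : 0 <= lattice_term e (w * x).
  by rewrite lattice_term_ge0 ?mulr_ge0 ?(ltW w0).
rewrite -addrA ler_wpDr//; first exact: addr_ge0.
apply: ler_sum => j _; rewrite lattice_term_shift.
rewrite le_eqVlt; apply/orP; left; apply/eqP; congr (_ * lattice_term _ _).
by rewrite -!natr1; ring.
Qed.

Local Notation q1 := (w `^ (p - 1)).
Local Notation q2 := (w `^ (- (p / 2))).

(** The bound ln (1 + t) <= t makes the tail towards small grid points geometric, because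
    [p < 1]. *)
Lemma lattice_term_negative k x : 0 <= x ->
  lattice_term (- k.+1%:R) x <= x * q1 ^+ k.
Proof.
move=> x0; have h0 : 0 <= w `^ (- k.+1%:R) * x by rewrite mulr_ge0 ?powR_ge0.
apply: (@le_trans _ _ (w `^ (- (p * - k.+1%:R)) * (w `^ (- k.+1%:R) * x))).
  by rewrite ler_wpM2l ?powR_ge0// le_ln1Dx//; lra_range.
rewrite mulrA -powRD ?wn0 ?implybT// mulrC ler_wpM2l//.
rewrite -powR_mulrn ?powR_ge0// -powRrM ler_powR ?(ltW w1)//.
rewrite [leLHS](_ : _ = (p - 1) * k%:R + (p - 1)); last by rewrite -natr1; ring.
by rewrite gerDl subr_le0 ltW.
Qed.

(** The logarithm is bounded by a multiple of the power p/2 of its argument; against the weight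
    w^(-pk) this leaves the geometric ratio w^(-p/2). *)
Lemma lattice_term_nonnegative k x : 0 <= x ->
  lattice_term k%:R x <= (2 / p) * (1 + x) `^ (p / 2) * q2 ^+ k.
Proof.
move=> x0; have ph : 0 < p / 2 by lra_range.
have wk1 : 1 <= w `^ k%:R by rewrite -[leLHS](powRr0 w) ler_powR ?(ltW w1).
have h : 1 + w `^ k%:R * x <= w `^ k%:R * (1 + x) by lra_range.
have h0 : 0 < 1 + w `^ k%:R * x by rewrite ltr_pwDl// mulr_ge0 ?powR_ge0.
have h1 : 0 < w `^ k%:R * (1 + x) by exact: lt_le_trans h.
have hl : ln (1 + w `^ k%:R * x) <= 2 / p * (w `^ k%:R * (1 + x)) `^ (p / 2).
  apply: (@le_trans _ _ (ln (w `^ k%:R * (1 + x)))); first by rewrite ler_ln.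
  have -> : ln (w `^ k%:R * (1 + x)) =
      2 / p * ln ((w `^ k%:R * (1 + x)) `^ (p / 2)).
    by rewrite ln_powR; field; rewrite gt_eqF.
  by rewrite ler_wpM2l ?divr_ge0 ?(ltW p0)// ltW// ln_sublinear// powR_gt0.
apply: (le_trans (ler_wpM2l (powR_ge0 _ _) hl)).
rewrite powRM ?powR_ge0 ?addr_ge0// -powRrM -powR_mulrn ?powR_ge0// -powRrM.
rewrite le_eqVlt; apply/orP; left; apply/eqP.
transitivity (2 / p * (1 + x) `^ (p / 2) *
    (w `^ (- (p * k%:R)) * w `^ (k%:R * (p / 2)))); first by ring.
by rewrite -powRD ?wn0 ?implybT//; congr (_ * _ `^ _); field.
Qed.

Lemma lattice_sum_bounded x : 0 <= x ->
  exists M, forall N, lattice_sum N x <= M.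
Proof.
move=> x0; set C := (2 / p) * (1 + x) `^ (p / 2).
have C0 : 0 <= C by rewrite mulr_ge0 ?powR_ge0// divr_ge0 ?(ltW p0).
have small r : r < 0 -> `|w `^ r| < 1.
  move=> r0; rewrite ger0_norm ?powR_ge0// -[ltRHS](powRr0 w) /powR (negPf wn0).
  by rewrite ltr_expR ltr_pM2r ?ln_gt0.
exists (x * (1 - q1)^-1 + C * (1 - q2)^-1) => N.
apply: (@le_trans _ _ (series (geometric x q1) N + series (geometric C q2) N)).
  elim: N => [|N IH].
    by rewrite /lattice_sum /series/= big_ord0 !big_geq// addr0.
  rewrite lattice_sumS /series/= !big_nat_recr//= -!/(series _ _).
  have := lattice_term_negative N x0; have := lattice_term_nonnegative N x0.
  by move: IH; rewrite /series/= -/C; lra_range.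
by apply: lerD; apply: geometric_le_lim; rewrite ?powR_gt0 ?small//; lra_range.
Qed.

Lemma lattice_sum_nondecreasing x : 0 <= x ->
  nondecreasing_seq (lattice_sum ^~ x).
Proof.
move=> x0; apply/nondecreasing_seqP => N; rewrite lattice_sumS.
have := lattice_term_ge0 (- N.+1%:R) x0; have := lattice_term_ge0 N%:R x0; lra_range.
Qed.

Lemma is_cvg_lattice_sum x : 0 <= x -> cvgn (lattice_sum ^~ x).
Proof.
move=> x0; apply: nondecreasing_is_cvgn; first exact: lattice_sum_nondecreasing.
have [M hM] := lattice_sum_bounded x0.
by exists M => _ [N _ <-]; exact: hM.
Qed.

Definition lattice_mean x : R := limn (lattice_sum ^~ x).

Lemma lattice_sum_le_mean N x : 0 <= x -> lattice_sum N x <= lattice_mean x.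
Proof.
move=> x0; apply: nondecreasing_cvgn_le; last exact: is_cvg_lattice_sum.
exact: lattice_sum_nondecreasing.
Qed.

Lemma lattice_mean_ub x M : 0 <= x ->
  (forall N, lattice_sum N x <= M) -> lattice_mean x <= M.
Proof.
move=> x0 hM; apply: limr_le; first exact: is_cvg_lattice_sum.
by near=> N; exact: hM.
Unshelve. all: by end_near. Qed.

Lemma lattice_mean_scale x : 0 <= x ->
  lattice_mean (w * x) = w `^ p * lattice_mean x.
Proof.
move=> x0; have wp0 : 0 < w `^ p by rewrite powR_gt0 ?w0.
have wx0 : 0 <= w * x by rewrite mulr_ge0 ?(ltW w0).
apply/le_anti/andP; split.
  apply: lattice_mean_ub => // N; apply: le_trans (lattice_sum_shift N x0) _.
  by rewrite ler_pM2l// lattice_sum_le_mean.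
rewrite -ler_pdivlMl//; apply: lattice_mean_ub => // N.
rewrite ler_pdivlMl//; apply: le_trans (lattice_sum_unshift N x0) _.
exact: lattice_sum_le_mean.
Qed.

Lemma lattice_mean_scaleX k x : 0 <= x ->
  lattice_mean (w ^+ k * x) = (w `^ p) ^+ k * lattice_mean x.
Proof.
move=> x0; elim: k => [|k IH]; first by rewrite !expr0 !mul1r.
by rewrite !exprS -!mulrA lattice_mean_scale ?IH// mulr_ge0 ?exprn_ge0 ?(ltW w0).
Qed.

Lemma lattice_mean_le x y : 0 <= x -> x <= y -> lattice_mean x <= lattice_mean y.
Proof.
move=> x0 xy; apply: lattice_mean_ub => // N.
by apply: le_trans (lattice_sum_le N x0 xy) _; rewrite lattice_sum_le_mean// (le_trans x0).
Qed.

Lemma lattice_mean0 : lattice_mean 0 = 0.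
Proof.
apply/le_anti/andP; split; last first.
  by apply: le_trans (lattice_sum_le_mean 0 (lexx 0)); rewrite /lattice_sum big_ord0.
apply: lattice_mean_ub => // N; rewrite /lattice_sum big1// => j _.
by rewrite /lattice_term mulr0 addr0 ln1 mulr0.
Qed.

Lemma lattice_mean1_gt0 : 0 < lattice_mean 1.
Proof.
apply: lt_le_trans (lattice_sum_le_mean 1 ler01).
rewrite lattice_sumS /lattice_sum big_ord0 addr0 ltr_wpDl ?lattice_term_ge0//.
by rewrite /lattice_term mulr0 oppr0 !powRr0 !mul1r ln_gt0//; lra_range.
Qed.

(** [lattice_mean] is known to be homogeneous of degree [p] for factors that are powers of [w].
    Enclosing [x] between consecutive powers and using monotonicity costs at most a factor w^p on
    either side. *)
Lemma lattice_mean_bounds x : 0 <= x ->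
  x `^ p * lattice_mean 1 <= w `^ p * lattice_mean x /\
  lattice_mean x <= w `^ p * (x `^ p * lattice_mean 1).
Proof.
rewrite le_eqVlt => /predU1P[<-|x0].
  by rewrite lattice_mean0 powR0 ?gt_eqF// !(mul0r, mulr0).
set u := w `^ p; have u0 : 0 < u by rewrite powR_gt0 ?w0.
have uk k : 0 < u ^+ k by rewrite exprn_gt0.
have wk k : 0 < w ^+ k by rewrite exprn_gt0 ?w0.
have wpk k : (w ^+ k) `^ p = u ^+ k.
  by rewrite -(powR_mulrn _ (ltW w0)) -(powR_mulrn _ (ltW u0)) powRAC.
have ge1 y : 1 <= y -> y `^ p * lattice_mean 1 <= u * lattice_mean y /\
    lattice_mean y <= u * (y `^ p * lattice_mean 1).
  move=> y1; have y0 : 0 < y by lra_range.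
  have lw : 0 < ln w by rewrite ln_gt0.
  have /andP[] := @truncn_itv _ (ln y / ln w) (divr_ge0 (ln_ge0 y1) (ltW lw)).
  set k := Num.trunc _; rewrite ler_pdivlMr// ltr_pdivrMr//.
  rewrite !mulr_natl -!(lnXn _ w0) ler_ln ?posrE// ltr_ln ?posrE// => h1 h2.
  have m1 := lattice_mean_le (ltW (wk k)) h1.
  have m2 := lattice_mean_le (ltW y0) (ltW h2).
  rewrite -[w ^+ _]mulr1 lattice_mean_scaleX// -/u in m1.
  rewrite -[w ^+ _]mulr1 lattice_mean_scaleX// -/u in m2.
  have p1' : y `^ p <= u ^+ k.+1.
    by rewrite -wpk ge0_ler_powR ?nnegrE ?(ltW p0) ?(ltW y0) ?(ltW (wk _)) ?(ltW h2).
  have p2' : u ^+ k <= y `^ p.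
    by rewrite -wpk ge0_ler_powR ?nnegrE ?(ltW p0) ?(ltW y0) ?(ltW (wk _)).
  have L0 := ltW lattice_mean1_gt0; split.
    apply: (@le_trans _ _ (u ^+ k.+1 * lattice_mean 1)); first by rewrite ler_wpM2r.
    by rewrite exprS -mulrA ler_pM2l.
  apply: (le_trans m2); rewrite exprS -mulrA ler_pM2l//.
  by rewrite ler_wpM2r.
(* Points below 1 are first multiplied by a power of [w]; the resulting factor cancels from both
   bounds. *)
have [k hk] : exists k, 1 <= w ^+ k * x.
  have lw : 0 < ln w by rewrite ln_gt0.
  exists (Num.bound (`|ln x| / ln w)).
  have := archi_boundP (divr_ge0 (normr_ge0 (ln x)) (ltW lw)).
  set k := Num.bound _; rewrite ltr_pdivrMr// mulr_natl -(lnXn _ w0) => h.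
  have : 0 <= ln (w ^+ k * x).
    by rewrite lnM ?posrE//; have := lerNnormlW (lexx `|ln x|); lra_range.
  by rewrite -[0](@ln1 R) ler_ln ?posrE ?mulr_gt0.
have [] := ge1 _ hk; rewrite powRM ?(ltW (wk k)) ?(ltW x0)// wpk.
rewrite lattice_mean_scaleX ?(ltW x0)// -/u.
rewrite -!mulrA !(mulrCA u) !ler_pM2l//.
Qed.

End LogarithmicMean.

(** The logarithms of the hypothesis at the grid points, weighted and summed, compare the lattice
    means of [x] and [y]. Up to a common constant these means are the p-th powers within a factor
    w^p on each side, and [w] may be taken arbitrarily close to 1. *)
Lemma sum_powR_le_prod (R : realType) (I : finType) (x y : I -> R) (p : R) :
  0 < p < 1 -> (forall i, 0 <= x i) -> (forall i, 0 <= y i) ->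
  (forall u, 0 < u -> \prod_i (1 + u * x i) <= \prod_i (1 + u * y i)) ->
  \sum_i x i `^ p <= \sum_i y i `^ p.
Proof.
move=> /andP[p0 p1] x0 y0 hxy.
have lnprod u (z : I -> R) : 0 < u -> (forall i, 0 <= z i) ->
    ln (\prod_i (1 + u * z i)) = \sum_i ln (1 + u * z i) /\
    0 < \prod_i (1 + u * z i).
  move=> u0 z0; have zp i : 0 < 1 + u * z i.
    by rewrite ltr_pwDl// mulr_ge0 ?(ltW u0).
  split; last by exact: prodr_gt0.
  (* The induction carries positivity along, since the logarithm of a product is split only for
     positive factors. *)
  pose K (a b : R) := 0 < a /\ ln a = b.
  suff [] : K (\prod_i (1 + u * z i)) (\sum_i ln (1 + u * z i)) by [].
  apply: (big_ind2 K) => [|a b c d [? <-] [? <-]|i _]; rewrite /K ?ln1//.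
  by rewrite lnM ?posrE ?mulr_gt0.
have grid w : 1 < w -> \sum_i x i `^ p <= w `^ p * (w `^ p * \sum_i y i `^ p).
  move=> w1; have w0 : 0 < w by lra.
  have L0 := lattice_mean1_gt0 w1 p0 p1; set L := lattice_mean w p in L0.
  have wp0 : 0 < w `^ p by exact: powR_gt0.
  have sums N : \sum_i lattice_sum w p N (x i) <= \sum_i lattice_sum w p N (y i).
    rewrite /lattice_sum exchange_big [leRHS]exchange_big/=.
    apply: ler_sum => j _; rewrite /lattice_term -!mulr_sumr.
    rewrite ler_wpM2l ?powR_ge0//; set u := w `^ _.
    have u0 : 0 < u by exact: powR_gt0.
    have [<- hx] := lnprod u x u0 x0; have [<- hy] := lnprod u y u0 y0.
    by rewrite ler_ln ?posrE// hxy.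
  have cv (z : I -> R) : (forall i, 0 <= z i) ->
      ((fun N => \sum_i lattice_sum w p N (z i)) @ \oo --> \sum_i L (z i))%classic.
    move=> z0; apply: cvg_big => [|i _]; [exact: add_continuous|exact: (is_cvg_lattice_sum w1 p0 p1 (z0 i))].
  have means : \sum_i L (x i) <= \sum_i L (y i).
    have cx := cv _ x0; have cy := cv _ y0.
    rewrite -(cvg_lim _ cx)// -(cvg_lim _ cy)//; apply: ler_lim.
    - by apply/cvg_ex; eexists; exact: cx.
    - by apply/cvg_ex; eexists; exact: cy.
    - by near=> N; exact: sums.
  rewrite -(ler_pM2r L0); apply: (@le_trans _ _ (w `^ p * \sum_i L (x i))).
    rewrite mulr_suml mulr_sumr; apply: ler_sum => i _.
    by have [] := lattice_mean_bounds w1 p0 p1 (x0 i).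
  rewrite -mulrA ler_pM2l//; apply: (le_trans means).
  rewrite -mulrA mulr_suml mulr_sumr; apply: ler_sum => i _.
  by have [] := lattice_mean_bounds w1 p0 p1 (y0 i).
set X := \sum_i _; set Y := \sum_i _; rewrite -/X -/Y in grid.
have Y0 : 0 <= Y by apply: sumr_ge0 => i _; exact: powR_ge0.
rewrite leNgt; apply/negP => YX.
have X0 : 0 < X by exact: le_lt_trans YX.
have [Y00|Yn0] := eqVneq Y 0.
  have two : 1 < 2%:R :> R by rewrite ltr1n.
  by have := grid _ two; rewrite Y00 !mulr0; lra.
have Yp : 0 < Y by rewrite lt_neqAle eq_sym Yn0.
have r1 : 1 < X / Y by rewrite ltr_pdivlMr// mul1r.
have r0 : 0 < X / Y by lra.
have gt1 (a : R) : 0 < a -> 1 < (X / Y) `^ a.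
  move=> a0; rewrite -[ltLHS](powRr0 (X / Y)) /powR gt_eqF// ltr_expR.
  by rewrite ltr_pM2r ?ln_gt0.
(* For w = (X/Y)^(1/(4p)) the error factor w^(2p) is the square root of X/Y, so [grid] would bound
   X/Y by its own square root although X/Y > 1. *)
have a0 : 0 < 4^-1 / p by rewrite divr_gt0 ?invr_gt0 ?ltr0n.
have := grid _ (gt1 _ a0).
rewrite -powRrM divfK ?gt_eqF// mulrA -powRD ?(gt_eqF r0) ?implybT// leNgt => /negP; apply.
rewrite -ltr_pdivlMr// -[ltRHS]powRr1 ?(ltW r0)// /powR gt_eqF// ltr_expR.
by rewrite ltr_pM2r ?ln_gt0//; lra.
Unshelve. all: by end_near. Qed.

(** * Hermitian matrices and functional calculus *)

Section Hermitian.
Variable R : realType.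
Local Notation C := R[i].
Implicit Types n : nat.

Lemma trmxC_mul m n k (A : 'M[C]_(m, n)) (B : 'M[C]_(n, k)) :
  (A *m B)^t* = B^t* *m A^t*.
Proof. by rewrite trmx_mul map_mxM. Qed.

Lemma trmxC_inv n (A : 'M[C]_n) : (invmx A)^t* = invmx (A^t*).
Proof. by rewrite trmx_inv map_invmx. Qed.

Lemma trmxC_unit n (A : 'M[C]_n) : (A^t* \in unitmx) = (A \in unitmx).
Proof. by rewrite map_unitmx unitmx_tr. Qed.

Lemma hermsymmxP n (X : 'M[C]_n) : reflect (X^t* = X) (X \is hermsymmx).
Proof.
apply: (iffP (is_hermitianmxP _ _ _)); rewrite expr0 scale1r => h.
  by rewrite [in RHS]h.
by rewrite h.
Qed.

Lemma mulmx1_invmx n (A B : 'M[C]_n) : A *m B = 1%:M -> invmx B = A.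
Proof.
by move=> AB; have [_ uB] := mulmx1_unit AB; rewrite -[LHS]mul1mx -AB mulmxK.
Qed.

Definition psdmx n (X : 'M[C]_n) : Prop :=
  X \is hermsymmx /\ forall v : 'rV[C]_n, 0 <= (v *m X *m v^t*) 0 0.

Lemma posdefmx_psd n (X : 'M[C]_n) : posdefmx X -> psdmx X.
Proof.
move=> [hX X0]; split=> // v; have [->|/X0/ltW//] := eqVneq v 0.
by rewrite !mul0mx mxE.
Qed.

Lemma hermsymmx_congr m n (F : 'M[C]_(m, n)) (X : 'M[C]_n) :
  X \is hermsymmx -> F *m X *m F^t* \is hermsymmx.
Proof.
by move=> /hermsymmxP hX; apply/hermsymmxP; rewrite !trmxC_mul trmxCK hX mulmxA.
Qed.

Lemma psdmx_congr m n (F : 'M[C]_(m, n)) (X : 'M[C]_n) :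
  psdmx X -> psdmx (F *m X *m F^t*).
Proof.
move=> [hX X0]; split=> [|v]; first exact: hermsymmx_congr.
by have := X0 (v *m F); rewrite trmxC_mul !mulmxA.
Qed.

Lemma posdefmx_congr n (F X : 'M[C]_n) : F \in unitmx ->
  posdefmx X -> posdefmx (F *m X *m F^t*).
Proof.
move=> uF [hX X0]; split=> [|v v0]; first exact: hermsymmx_congr.
have := X0 (v *m F); rewrite trmxC_mul !mulmxA; apply.
by apply: contra v0 => /eqP/(congr1 (mulmx^~ (invmx F))); rewrite mulmxK// mul0mx => ->.
Qed.

Lemma posdefmx_unit n (X : 'M[C]_n) : posdefmx X -> X \in unitmx.
Proof.
move=> [_ X0]; rewrite -row_free_unit -kermx_eq0; apply/eqP/row_matrixP => i.
apply/eqP; rewrite row0; apply/negPn/negP => /X0.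
by rewrite -row_mul mulmx_ker row0 mul0mx mxE ltxx.
Qed.

Lemma posdefmx_inv n (X : 'M[C]_n) : posdefmx X -> posdefmx (invmx X).
Proof.
move=> pX; have uX := posdefmx_unit pX; have /hermsymmxP hX := pX.1.
have uV : invmx X \in unitmx by rewrite unitmx_inv.
by have := posdefmx_congr uV pX; rewrite trmxC_inv hX (mulVmx uX) mul1mx.
Qed.

Definition rdiag_mx n (d : 'I_n -> R) : 'M[C]_n := diag_mx (\row_i (d i)%:C).

Lemma rdiag_mxM n (d e : 'I_n -> R) :
  rdiag_mx d *m rdiag_mx e = rdiag_mx (fun i => d i * e i).
Proof.
rewrite /rdiag_mx mulmx_diag; congr diag_mx; apply/rowP => i.
by rewrite !mxE rmorphM.
Qed.

Lemma eq_rdiag_mx n (d e : 'I_n -> R) : d =1 e -> rdiag_mx d = rdiag_mx e.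
Proof. by move=> de; congr diag_mx; apply/rowP => i; rewrite !mxE de. Qed.

Lemma rdiag_mx1 n : rdiag_mx (fun=> 1) = 1%:M :> 'M[C]_n.
Proof. by apply/matrixP => i j; rewrite !mxE. Qed.

Lemma conj_real_complex (x : R) : Num.conj (x%:C : C) = x%:C.
Proof. by apply: conj_Creal; apply/complex_realP; exists x. Qed.

Lemma rdiag_mx_herm n (d : 'I_n -> R) : rdiag_mx d \is hermsymmx.
Proof.
apply/hermsymmxP; rewrite /rdiag_mx tr_diag_mx map_diag_mx; congr diag_mx.
by apply/rowP => i; rewrite !mxE; exact: conj_real_complex.
Qed.

Lemma rdiag_mx_form n (d : 'I_n -> R) (v : 'rV[C]_n) :
  (v *m rdiag_mx d *m v^t*) 0 0 = \sum_i (d i)%:C * (v 0 i * Num.conj (v 0 i)).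
Proof.
rewrite mxE; apply: eq_bigr => i _; rewrite mul_mx_diag !mxE; ring.
Qed.

Lemma rdiag_mx_psd n (d : 'I_n -> R) : (forall i, 0 <= d i) -> psdmx (rdiag_mx d).
Proof.
move=> d0; split=> [|v]; first exact: rdiag_mx_herm.
rewrite rdiag_mx_form sumr_ge0// => i _.
by rewrite mulr_ge0 ?mul_conjC_ge0// lecR.
Qed.

Lemma rdiag_mx_posdef n (d : 'I_n -> R) :
  (forall i, 0 < d i) -> posdefmx (rdiag_mx d).
Proof.
move=> d0; split=> [|v v0]; first exact: rdiag_mx_herm.
have [i vi] : exists i, v 0 i != 0.
  apply/existsP; apply: contraR v0 => /existsPn h; apply/eqP/rowP => i.
  by rewrite !mxE; apply/eqP/negPn; exact: h.
rewrite rdiag_mx_form (bigD1 i)//= ltr_pwDl//.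
  by rewrite mulr_gt0 ?mul_conjC_gt0// ltcR.
by rewrite sumr_ge0// => j _; rewrite mulr_ge0 ?mul_conjC_ge0// lecR ltW.
Qed.

Definition rspec n (X : 'M[C]_n) (i : 'I_n) : R := complex.Re (spectral_diag X 0 i).

Lemma mxfunE n (f : R -> R) (X : 'M[C]_n) :
  mxfun f X = (spectralmx X)^t* *m rdiag_mx (f \o rspec X) *m spectralmx X.
Proof.
rewrite /mxfun (invmx_unitary (spectral_unitarymx X)).
have -> : map_mx (fun z : C => (f (complex.Re z))%:C) (spectral_diag X) =
    \row_i (f (rspec X i))%:C by apply/rowP => i; rewrite !mxE.
by [].
Qed.

Lemma spectralE n (X : 'M[C]_n) : X \is hermsymmx ->
  X = (spectralmx X)^t* *m rdiag_mx (rspec X) *m spectralmx X.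
Proof.
move=> hX; have /orthomx_spectralP XE := hermitian_normalmx hX.
have dE : \row_i (rspec X i)%:C = spectral_diag X.
  have /mxOverP dR := hermitian_spectral_diag_real hX.
  by apply/rowP => i; rewrite mxE RRe_real.
by rewrite /rdiag_mx dE -(invmx_unitary (spectral_unitarymx X)).
Qed.

Lemma mxE_row_form n (F X : 'M[C]_n) i :
  (row i F *m X *m (row i F)^t*) 0 0 = (F *m X *m F^t*) i i.
Proof.
rewrite -row_mul [LHS]mxE [RHS]mxE; apply: eq_bigr => j _.
by rewrite [row i _ _ _]mxE; congr (_ * _); rewrite !mxE.
Qed.

(** Carries (semi)definiteness over to the spectrum: the rows of [spectralmx X] are orthonormal
    eigenvectors. *)
Lemma rspecE n (X : 'M[C]_n) i : X \is hermsymmx ->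
  (rspec X i)%:C = (row i (spectralmx X) *m X *m (row i (spectralmx X))^t*) 0 0.
Proof.
move=> hX; rewrite mxE_row_form {3}(spectralE hX) !mulmxA.
have /unitarymxP -> := spectral_unitarymx X.
rewrite mul1mx -mulmxA; have /unitarymxP -> := spectral_unitarymx X.
by rewrite mulmx1 !mxE eqxx mulr1n.
Qed.

Lemma rspec_ge0 n (X : 'M[C]_n) i : psdmx X -> 0 <= rspec X i.
Proof. by move=> [hX X0]; rewrite -lecR rspecE. Qed.

Lemma rspec_gt0 n (X : 'M[C]_n) i : posdefmx X -> 0 < rspec X i.
Proof.
move=> [hX X0]; rewrite -ltcR rspecE// X0//; apply/eqP => r0.
have /unitarymxP/row_matrixP/(_ i) := spectral_unitarymx X.
rewrite row_mul r0 mul0mx => /rowP/(_ i); rewrite !mxE eqxx => /eqP.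
by rewrite eq_sym oner_eq0.
Qed.

Lemma mxfun_mul n (f g : R -> R) (X : 'M[C]_n) :
  mxfun f X *m mxfun g X = mxfun (fun x => f x * g x) X.
Proof.
rewrite !mxfunE; move: (spectral_unitarymx X) (rspec X).
move: (spectralmx X) => U uU d; rewrite !mulmxA (mulmxtVK _ uU).
have -> : rdiag_mx ((fun x => f x * g x) \o d) = rdiag_mx (f \o d) *m rdiag_mx (g \o d).
  by rewrite rdiag_mxM.
by rewrite mulmxA.
Qed.

Lemma eq_mxfun n (f g : R -> R) (X : 'M[C]_n) :
  (forall i, f (rspec X i) = g (rspec X i)) -> mxfun f X = mxfun g X.
Proof.
move=> fg; rewrite !mxfunE.
have -> : rdiag_mx (f \o rspec X) = rdiag_mx (g \o rspec X) by exact: eq_rdiag_mx.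
by [].
Qed.

Lemma mxpowRD n (X : 'M[C]_n) (a b : R) : posdefmx X ->
  mxpowR X a *m mxpowR X b = mxpowR X (a + b).
Proof.
move=> pX; rewrite /mxpowR mxfun_mul; apply: eq_mxfun => i.
by rewrite powRD// (gt_eqF (rspec_gt0 i pX)) implybT.
Qed.

Lemma mxpowR0 n (X : 'M[C]_n) : mxpowR X 0 = 1%:M.
Proof.
rewrite /mxpowR mxfunE (@eq_rdiag_mx _ _ (fun=> 1)); last first.
  by move=> i; rewrite /= powRr0.
rewrite rdiag_mx1 mulmx1 -(invmx_unitary (spectral_unitarymx X)).
by rewrite mulVmx ?spectral_unit.
Qed.

Lemma mxpowR1 n (X : 'M[C]_n) : psdmx X -> mxpowR X 1 = X.
Proof.
move=> pX; rewrite /mxpowR mxfunE (@eq_rdiag_mx _ _ (rspec X)) -?(spectralE pX.1)//.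
by move=> i /=; rewrite powRr1 ?rspec_ge0.
Qed.

Lemma mxpowR_posdef n (X : 'M[C]_n) (a : R) : posdefmx X -> posdefmx (mxpowR X a).
Proof.
move=> pX; rewrite /mxpowR mxfunE.
have : posdefmx (rdiag_mx ((fun x => x `^ a) \o rspec X)).
  by apply: rdiag_mx_posdef => i /=; rewrite powR_gt0// rspec_gt0.
have uU : (spectralmx X)^t* \in unitmx by rewrite trmxC_unit spectral_unit.
by move=> /(posdefmx_congr uU); rewrite trmxCK.
Qed.

Lemma mxpowR_half n (X : 'M[C]_n) (a : R) : posdefmx X ->
  mxpowR X (a / 2) *m mxpowR X (a / 2) = mxpowR X a.
Proof. by move=> pX; rewrite (mxpowRD _ _ pX) -splitr. Qed.

Lemma mxpowRN1 n (X : 'M[C]_n) : posdefmx X -> mxpowR X (- 1) = invmx X.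
Proof.
move=> pX; have uX := posdefmx_unit pX; apply: (can_inj (mulKmx uX)).
rewrite mulmxV// -{1}(mxpowR1 (posdefmx_psd pX)) mxpowRD// subrr mxpowR0.
by [].
Qed.

End Hermitian.

(** * Traces of powers *)

Section EigenvalueTrace.
Variable R : realType.
Local Notation C := R[i].
Implicit Types n : nat.

Lemma char_poly_conj n (P M : 'M[C]_n) : P \in unitmx ->
  char_poly (invmx P *m M *m P) = char_poly M.
Proof.
move=> uP; rewrite /char_poly /char_poly_mx !map_mxM.
set Q := map_mx polyC P; set Qi := map_mx polyC (invmx P).
have QiQ : Qi *m Q = 1%:M by rewrite -map_mxM mulVmx// map_mx1.
have -> : 'X%:M - Qi *m map_mx polyC M *m Q = Qi *m ('X%:M - map_mx polyC M) *m Q.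
  by rewrite mulmxBr mulmxBl mul_mx_scalar -scalemxAl QiQ scalemx1.
by rewrite !det_mulmx mulrAC -det_mulmx QiQ det1 mul1r.
Qed.

Lemma char_poly_mulC n (A B : 'M[C]_n) : B \in unitmx ->
  char_poly (A *m B) = char_poly (B *m A).
Proof. by move=> uB; rewrite -(char_poly_conj (B *m A) uB) mulKmx. Qed.

Definition char_roots n (M : 'M[C]_n) : seq C :=
  sval (closed_field_poly_normal (char_poly M)).

Lemma char_rootsE n (M : 'M[C]_n) :
  char_poly M = \prod_(z <- char_roots M) ('X - z%:P).
Proof.
rewrite /char_roots; case: closed_field_poly_normal => r /= {1}->.
by rewrite (monicP (char_poly_monic M)) scale1r.
Qed.

(* [Tr (M ^ r)] for every [M] with nonnegative eigenvalues, Hermitian or not: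
   unlike [trpowR] it is defined through the characteristic polynomial, hence
   invariant under similarity. *)
Definition etr n (M : 'M[C]_n) (r : R) : R :=
  \sum_(z <- char_roots M) complex.Re z `^ r.

Lemma eq_etr n (M N : 'M[C]_n) r : char_poly M = char_poly N -> etr M r = etr N r.
Proof. by rewrite /etr /char_roots => ->. Qed.

Lemma etr_rdiag n (d : 'I_n -> R) r : etr (rdiag_mx d) r = \sum_i d i `^ r.
Proof.
have pE : perm_eq (char_roots (rdiag_mx d)) [seq (d i)%:C | i : 'I_n].
  apply: prod_XsubC_eq; rewrite -char_rootsE big_image /=.
  rewrite char_poly_trig ?diag_mx_is_trig//; apply: eq_bigr => i _.
  by rewrite !mxE eqxx.
by rewrite /etr (perm_big _ pE) big_image.
Qed.

Lemma etr_mulC n (A B : 'M[C]_n) r : B \in unitmx -> etr (A *m B) r = etr (B *m A) r.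
Proof. by move=> uB; apply: eq_etr; exact: char_poly_mulC. Qed.

Lemma etr_spectral n (X : 'M[C]_n) r : X \is hermsymmx ->
  etr X r = \sum_i rspec X i `^ r.
Proof.
move=> hX; rewrite -etr_rdiag; apply: eq_etr.
rewrite {1}(spectralE hX) -(invmx_unitary (spectral_unitarymx X)).
by rewrite char_poly_conj ?spectral_unit.
Qed.

Lemma trpowR_etr n (X : 'M[C]_n) r : X \is hermsymmx -> trpowR X r = etr X r.
Proof.
move=> hX; rewrite (etr_spectral _ hX) /trpowR /mxpowR mxfunE.
rewrite mxtrace_mulC mulmxA.
have /unitarymxP -> := spectral_unitarymx X.
rewrite mul1mx mxtrace_diag raddf_sum; apply: eq_bigr => i _.
by rewrite mxE.
Qed.

Lemma etr_inv n (X : 'M[C]_n) r : posdefmx X -> etr (invmx X) (- r) = etr X r.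
Proof.
move=> pX; rewrite (etr_spectral _ pX.1) -(mxpowRN1 pX) /mxpowR mxfunE.
rewrite -(invmx_unitary (spectral_unitarymx X)).
rewrite (eq_etr _ (char_poly_conj _ (spectral_unit X))) etr_rdiag.
apply: eq_bigr => i _ /=; rewrite -powRrM; congr (_ `^ _); ring.
Qed.

Lemma etr_ge0 n (M : 'M[C]_n) r : 0 <= etr M r.
Proof. by apply: sumr_ge0 => z _; exact: powR_ge0. Qed.

Lemma etr_gt0 n (X : 'M[C]_n.+1) r : posdefmx X -> 0 < etr X r.
Proof.
move=> pX; rewrite (etr_spectral _ pX.1) big_ord_recl ltr_pwDl//.
  by rewrite powR_gt0 ?rspec_gt0.
by apply: sumr_ge0 => i _; exact: powR_ge0.
Qed.

End EigenvalueTrace.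

(** * Lower bound for the determinant of 1 + L D L^* with triangular L *)

Section Weyl.
Variable R : realType.
Local Notation C := R[i].
Implicit Types n : nat.

(** Clearing the block [x] of the same matrix [B] by row operations and by column operations yields
    the two determinants. *)
Lemma det_1D_col_row n (x : 'cV[C]_n) (y : 'rV[C]_n) :
  \det (1%:M + x *m y) = 1 + (y *m x) 0 0.
Proof.
pose B : 'M_(1 + n) := block_mx 1%:M (- y) x 1%:M.
have B1 : B = block_mx 1%:M 0 x 1%:M *m block_mx 1%:M (- y) 0 (1%:M + x *m y).
  rewrite mulmx_block !mul1mx !mul0mx mulmx1 !addr0 mulmxN.
  by rewrite [- _ + _]addrC addrK.
have B2 : B = block_mx (1%:M + y *m x) (- y) 0 1%:M *m block_mx 1%:M 0 x 1%:M.
  rewrite mulmx_block !mul1mx !mul0mx !mulmx1 !mulmx0 !add0r mulNmx.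
  by rewrite addrK.
have := congr1 determinant B2; rewrite {1}B1 !det_mulmx.
rewrite !det_lblock !det_ublock !det1 !mul1r !mulr1 => ->.
by rewrite det_mx11 !mxE eqxx.
Qed.

Lemma posdefmx_1D_psd n (X : 'M[C]_n) : psdmx X -> posdefmx (1%:M + X).
Proof.
move=> [/hermsymmxP hX X0]; have [h1 p1] : posdefmx (1%:M : 'M[C]_n).
  by rewrite -rdiag_mx1; exact: rdiag_mx_posdef.
split=> [|v v0].
  apply/hermsymmxP; have /hermsymmxP e1 := h1.
  by rewrite linearD/= map_mxD hX e1.
by rewrite mulmxDr mulmxDl mxE ltr_wpDr ?p1.
Qed.

(** Induction on the size. Splitting off the first column [w] of [L] writes the matrix as diag(1, M)
    + D_0 w w^*, where [M] is the same expression for the trailing block. By the rank one formula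
    its determinant is det M times 1 + D_0 w^* diag(1, M)^-1 w, and positivity of M^-1 bounds the
    second factor below by 1 + D_0 |L_00|^2. *)
Lemma det_1D_trig_ge n (L : 'M[C]_n) (D : 'I_n -> R) : is_trig_mx L ->
  (forall i, 0 <= D i) ->
  0 <= \prod_i (1 + (D i)%:C * (L i i * Num.conj (L i i)))
    <= \det (1%:M + L *m rdiag_mx D *m L^t*).
Proof.
move=> trL D0; apply/andP; split.
  apply: prodr_ge0 => i _; rewrite addr_ge0// mulr_ge0 ?mul_conjC_ge0//.
  by rewrite lecR.
elim: n L D trL D0 => [|n IH] L D trL D0; first by rewrite big_ord0 det_mx00.
pose a := ulsubmx (L : 'M_(1 + n)); pose c := dlsubmx (L : 'M_(1 + n)).
pose L' := drsubmx (L : 'M_(1 + n)); pose D' i := D (lift ord0 i).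
have LE : L = block_mx a 0 c L' :> 'M_(1 + n).
  by rewrite -[LHS](@submxK _ 1 n 1 n) ursubmx_trig.
have trL' : is_trig_mx L' by exact: drsubmx_trig.
have DE : rdiag_mx D = block_mx (D ord0)%:C%:M 0 0 (rdiag_mx D') :> 'M_(1 + n).
  rewrite /rdiag_mx -diag_const_mx -diag_mx_row; congr diag_mx.
  rewrite -[LHS](@hsubmxK _ 1 1 n); congr row_mx; apply/rowP => i; rewrite !mxE.
    by congr (D _)%:C; apply: val_inj; rewrite /= ord1.
  by congr (D _)%:C; apply: val_inj.
have psdL' : psdmx (L' *m rdiag_mx D' *m L'^t*).
  by apply: psdmx_congr; apply: rdiag_mx_psd => i; exact: D0.
have pM := posdefmx_1D_psd psdL'; set M := 1%:M + _ in pM.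
have uM := posdefmx_unit pM.
pose w : 'cV_(1 + n) := col_mx a c.
have LsE : L^t* = block_mx (a^t*) (c^t*) 0 (L'^t*) :> 'M_(1 + n).
  by rewrite {1}LE (@tr_block_mx _ 1 n 1 n) (@map_block_mx _ _ _ 1 n 1 n) trmx0 map_mx0.
have wsE : w^t* = row_mx (a^t*) (c^t*) by rewrite tr_col_mx map_row_mx.
pose z := block_mx 1%:M 0 0 (invmx M) *m w.
have HE : 1%:M + block_mx a 0 c L' *m block_mx (D ord0)%:C%:M 0 0 (rdiag_mx D')
      *m block_mx (a^t*) (c^t*) 0 (L'^t*) =
    block_mx 1%:M 0 0 M *m (1%:M + z *m ((D ord0)%:C *: w^t*)) :> 'M_(1 + n).
  have MV : block_mx 1%:M 0 0 M *m block_mx 1%:M 0 0 (invmx M) = 1%:M :> 'M_(1 + n).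
    rewrite mulmx_block !(mul0mx, mulmx0, mul1mx, addr0, add0r) mulmxV//.
    by rewrite -scalar_mx_block.
  rewrite /z mulmxDr mulmx1 !mulmxA MV mul1mx.
  rewrite wsE !mulmx_block !(mul0mx, mulmx0, addr0, add0r).
  rewrite -scalemxAr mul_col_row scale_block_mx (scalar_mx_block 1 n 1).
  rewrite !add_block_mx !(add0r, addr0) !mul_mx_scalar -!scalemxAl /M.
  by congr block_mx; rewrite addrCA addrC.
have -> : \det (1%:M + L *m rdiag_mx D *m L^t*) =
    \det M * (1 + ((D ord0)%:C *: w^t* *m z) 0 0).
  rewrite LsE [in LHS]LE DE; move: (congr1 (@determinant _ (1 + n)) HE).
  by rewrite det_mulmx det_ublock det1 mul1r det_1D_col_row.
rewrite big_ord_recl mulrC; apply: ler_pM.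
- apply: prodr_ge0 => i _; rewrite addr_ge0// mulr_ge0 ?mul_conjC_ge0//.
  by rewrite lecR.
- by rewrite addr_ge0// mulr_ge0 ?mul_conjC_ge0// lecR.
- have := IH L' D' trL' (fun i => D0 _); apply: le_trans.
  rewrite le_eqVlt; apply/orP; left; apply/eqP; apply: eq_bigr => i _.
  by rewrite /D' !mxE; congr (1 + _ * (L _ _ * Num.conj (L _ _))); apply: val_inj.
rewrite lerD2l -scalemxAl mxE ler_wpM2l ?lecR//.
have -> : w^t* *m z = a^t* *m a + c^t* *m invmx M *m c.
  rewrite /z wsE mul_block_col !(mul0mx, mul1mx, add0r, addr0) mul_row_col.
  by rewrite mulmxA.
have aE : (a^t* *m a) 0 0 = L ord0 ord0 * Num.conj (L ord0 ord0).
  rewrite mxE big_ord1 !mxE mulrC.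
  by congr (L _ _ * Num.conj (L _ _)); apply: val_inj.
rewrite mxE aE lerDl.
by have := (posdefmx_psd (posdefmx_inv pM)).2 (c^t*); rewrite trmxCK.
Qed.

End Weyl.

(** * Weyl's majorant theorem for powers *)

Section WeylPower.
Variable R : realType.
Local Notation C := R[i].
Implicit Types n : nat.

Definition sqnorm (z : C) : R := complex.Re (z * Num.conj z).

Lemma sqnormE (z : C) : (sqnorm z)%:C = z * Num.conj z.
Proof. by rewrite RRe_real// ger0_real ?mul_conjC_ge0. Qed.

Lemma sqnorm_ge0 (z : C) : 0 <= sqnorm z.
Proof. by rewrite -lecR sqnormE mul_conjC_ge0. Qed.

Lemma rdiag_mx_congr_diag n (F : 'M[C]_n) (d : 'I_n -> R) i :
  (F *m rdiag_mx d *m F^t*) i i = (\sum_j sqnorm (F i j) * d j)%:C.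
Proof.
rewrite -mxE_row_form rdiag_mx_form raddf_sum; apply: eq_bigr => j _ /=.
by rewrite rmorphM/= sqnormE mulrC !mxE.
Qed.

Lemma unitary_sqnorm_sum n (U : 'M[C]_n) i : U \is unitarymx ->
  \sum_j sqnorm (U i j) = 1.
Proof.
move=> /unitarymxP/matrixP/(_ i i); rewrite !mxE eqxx => h.
apply: (@complexI R); rewrite raddf_sum -[RHS]h; apply: eq_bigr => j _ /=.
by rewrite sqnormE !mxE.
Qed.

Lemma scale_mul_rdiag m n k (A : 'M[C]_(m, n)) (B : 'M[C]_(n, k)) (d : 'I_n -> R)
    (u : R) :
  u%:C *: (A *m rdiag_mx d *m B) = A *m rdiag_mx (fun i => u * d i) *m B.
Proof.
rewrite scalemxAl scalemxAr; congr (_ *m _ *m _).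
by apply/matrixP => i j; rewrite !mxE rmorphM/= mulrnAr.
Qed.

Lemma det_1D_scale_herm n (X : 'M[C]_n) (u : R) : X \is hermsymmx ->
  \det (1%:M + u%:C *: X) = (\prod_i (1 + u * rspec X i))%:C.
Proof.
move=> hX; move: (spectralE hX) (spectral_unitarymx X).
move: (spectralmx X) (rspec X) => U x XE uU.
have -> : 1%:M + u%:C *: X = invmx U *m rdiag_mx (fun i => 1 + u * x i) *m U.
  rewrite XE -(invmx_unitary uU) scale_mul_rdiag.
  have -> : rdiag_mx (fun i => 1 + u * x i) = 1%:M + rdiag_mx (fun i => u * x i).
    by apply/matrixP => i j; rewrite !mxE rmorphD mulrnDl.
  by rewrite mulmxDr mulmxDl mulmx1 (mulVmx (unitarymx_unit uU)).
rewrite !det_mulmx mulrAC -det_mulmx mulVmx ?unitarymx_unit// det1 mul1r.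
rewrite det_diag rmorph_prod; apply: eq_bigr => i _.
by rewrite mxE.
Qed.

(* Weyl's majorant theorem. For [p < 1] the determinants [det (1 + u H)] are
   averaged over [u]; for [1 <= p] the diagonal entries of [H] are compared with
   its eigenvalues by Jensen's inequality. *)
Lemma weyl_powR n (L : 'M[C]_n) (D : 'I_n -> R) (p : R) : is_trig_mx L ->
  (forall i, 0 <= D i) -> 0 < p ->
  \sum_i (D i * sqnorm (L i i)) `^ p <= etr (L *m rdiag_mx D *m L^t*) p.
Proof.
move=> trL D0 p0; set H := L *m rdiag_mx D *m L^t*.
have pH : psdmx H by apply: psdmx_congr; exact: rdiag_mx_psd.
have Dl0 i : 0 <= D i * sqnorm (L i i) by rewrite mulr_ge0 ?sqnorm_ge0.
rewrite (etr_spectral _ pH.1); have [p1|p1] := ltP p 1.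
  apply: sum_powR_le_prod => [|//|i|u u0]; [by rewrite p0|exact: rspec_ge0|].
  have uD0 i : 0 <= u * D i by rewrite mulr_ge0// ltW.
  have /andP[_] := det_1D_trig_ge trL uD0.
  have -> : L *m rdiag_mx (fun i => u * D i) *m L^t* = u%:C *: H by rewrite scale_mul_rdiag.
  rewrite (det_1D_scale_herm _ pH.1) -lecR; apply: le_trans.
  rewrite rmorph_prod le_eqVlt; apply/orP; left; apply/eqP.
  by apply: eq_bigr => i _; rewrite rmorphD !rmorphM/= sqnormE mulrA.
set U := spectralmx H; have uU : U \is unitarymx := spectral_unitarymx H.
have uUs : U^t* \is unitarymx by rewrite trmxC_unitary.
(* The diagonal entries of [H], computed once from [L] and once from the spectral decomposition. *)
have HE i : \sum_j sqnorm (L i j) * D j = \sum_j sqnorm ((U^t*) i j) * rspec H j.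
  apply: (@complexI R); rewrite -!rdiag_mx_congr_diag trmxCK -/H.
  by rewrite [in LHS](spectralE pH.1).
apply: (@le_trans _ _ (\sum_i \sum_j sqnorm ((U^t*) i j) * rspec H j `^ p)).
  apply: ler_sum => i _; apply: le_trans (jensen_powR p1 _ _ _); first last.
  - by move=> j; exact: rspec_ge0.
  - exact: unitary_sqnorm_sum.
  - by move=> j; exact: sqnorm_ge0.
  have h : D i * sqnorm (L i i) <= \sum_j sqnorm ((U^t*) i j) * rspec H j.
    rewrite -HE (bigD1 i)//= [leLHS]mulrC lerDl sumr_ge0// => j _.
    by rewrite mulr_ge0 ?sqnorm_ge0.
  by rewrite ge0_ler_powR ?nnegrE ?(ltW p0) ?Dl0 ?(le_trans (Dl0 i)).
(* The squared moduli of a unitary matrix sum to 1 along columns as well as along rows, so each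
   eigenvalue ends up with total weight 1. *)
rewrite exchange_big/= le_eqVlt; apply/orP; left; apply/eqP.
apply: eq_bigr => j _; rewrite -mulr_suml -[RHS]mul1r; congr (_ * _).
rewrite -(unitary_sqnorm_sum j uU); apply: eq_bigr => i _.
by apply: (@complexI R); rewrite !sqnormE !mxE conjCK mulrC.
Qed.

End WeylPower.

(** * Hoelder's inequality for traces *)

(** Inserting m_i l_i = 1 splits d_i into d_i m_i and l_i, to which the scalar inequality applies.
    In use, [m] and [l] hold the squared moduli of the diagonal entries of L^-1 and L. *)
Lemma holder_sum_reciprocal (R : realType) (I : finType) (d m l : I -> R)
    (s r t a E1 E2 : R) : 0 < a < 1 -> r * (1 - a) = s -> t * a = s ->
  (forall i, 0 <= d i) -> (forall i, 0 <= m i) -> (forall i, 0 <= l i) ->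
  (forall i, m i * l i = 1) ->
  \sum_i (d i * m i) `^ r <= E1 -> \sum_i l i `^ t <= E2 ->
  \sum_i d i `^ s <= E1 `^ (1 - a) * E2 `^ a.
Proof.
move=> a01 rs ts d0 m0 l0 ml h1 h2; have /andP[a0 a1] := a01.
have s1 : 0 <= \sum_i (d i * m i) `^ r by apply: sumr_ge0 => i _; exact: powR_ge0.
have s2 : 0 <= \sum_i l i `^ t by apply: sumr_ge0 => i _; exact: powR_ge0.
have -> : \sum_i d i `^ s =
    \sum_i ((d i * m i) `^ r) `^ (1 - a) * (l i `^ t) `^ a.
  apply: eq_bigr => i _; rewrite -!powRrM rs ts -powRM ?mulr_ge0//.
  by rewrite -mulrA ml mulr1.
apply: le_trans (holder_sum a01 _ _) _ => [i|i|]; [exact: powR_ge0..|].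
apply: ler_pM; [exact: powR_ge0..| |].
  by rewrite ge0_ler_powR ?nnegrE ?(le_trans s1 h1) ?subr_ge0 ?(ltW a1).
by rewrite ge0_ler_powR ?nnegrE ?(le_trans s2 h2) ?(ltW a0).
Qed.

Section TraceHolder.
Variable R : realType.
Local Notation C := R[i].
Implicit Types n : nat.

Lemma mxpowR_sqrt n (Y : 'M[C]_n) : posdefmx Y ->
  mxpowR Y (1 / 2) *m mxpowR Y (1 / 2) = Y.
Proof. by move=> pY; rewrite (mxpowR_half _ pY) (mxpowR1 (posdefmx_psd pY)). Qed.

(** Gram-Schmidt on the rows of the square root [S] of [P] gives S = L Q with Q = [schmidt S]
    unitary. Row i of [S] lies in the span of the rows of Q of index at most i, so L = S Q^* is
    lower triangular. *)
Lemma cholesky n (P : 'M[C]_n) : posdefmx P ->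
  exists2 L : 'M[C]_n, is_trig_mx L & P = L *m L^t*.
Proof.
move=> pP; have SS := mxpowR_sqrt pP.
have [/hermsymmxP hS _] := mxpowR_posdef (1 / 2) pP.
move: (mxpowR P (1 / 2)) => S in SS hS.
have uB := schmidt_unitarymx S (leqnn n).
exists (S *m (schmidt S)^t*); last first.
  rewrite trmxC_mul trmxCK hS !mulmxA.
  have /unitarymxP := uB; rewrite -{1}(trmxCK (schmidt S)) => BB.
  rewrite -(mulmxA S) -{2}(trmxCK (schmidt S)).
  have uBs : (schmidt S)^t* \is unitarymx by rewrite trmxC_unitary.
  by have /unitarymxP -> := uBs; rewrite mulmx1.
apply/is_trig_mxP => i j ij.
have : (row i S <= kermx ((row j (schmidt S))^t*))%MS.
  apply: submx_trans (row_schmidt_sub S i) _.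
  apply/sumsmx_subP => k ki; rewrite genmxE; apply/sub_kermxP/matrixP => a b.
  rewrite [RHS]mxE; transitivity ((schmidt S *m (schmidt S)^t*) k j).
    by rewrite [LHS]mxE [RHS]mxE !ord1; apply: eq_bigr => l _; rewrite !mxE.
  have /unitarymxP -> := uB; rewrite mxE.
  by have -> : (k == j) = false by apply/negbTE; rewrite neq_ltn (leq_ltn_trans ki ij).
move=> /sub_kermxP/matrixP/(_ 0 0); rewrite [LHS]mxE [RHS]mxE => <-; rewrite mxE.
by apply: eq_bigr => l _; rewrite !mxE.
Qed.

(** Forward substitution: row i of L M = 1 determines row i of [M] from the earlier rows, the
    diagonal of [L] being nonzero. *)
Lemma trig_mx_inv n (L M : 'M[C]_n) : is_trig_mx L -> L \in unitmx ->
  L *m M = 1%:M -> is_trig_mx M /\ forall i, L i i * M i i = 1.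
Proof.
move=> trL uL LM.
have Lii i : L i i != 0.
  move: uL; rewrite unitmxE det_trig// unitfE => /prodf_neq0; exact.
have L0 (i j : 'I_n) : (i < j)%N -> L i j = 0 by move/is_trig_mxP: trL; exact.
have row_eq (i j : 'I_n) : L i i * M i j + \sum_(k < n | (k < i)%N) L i k * M k j = (i == j)%:R.
  have /matrixP/(_ i j) := LM; rewrite !mxE => <-.
  rewrite [RHS](bigD1 i)//=; congr (_ + _).
  rewrite [RHS](bigID (fun k : 'I_n => (k < i)%N))/= [X in _ + X]big1 ?addr0.
    by apply: eq_bigl => k; rewrite neq_ltn; case: ltngtP.
  move=> k /andP[ki]; rewrite -leqNgt leq_eqVlt => /orP[/eqP/val_inj ik|ik].
    by rewrite ik eqxx in ki.
  by rewrite L0// mul0r.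
have M0 (i j : 'I_n) : (i < j)%N -> M i j = 0.
  have [m] := ubnP (i : nat); elim: m i => // m IH i im ij.
  have := row_eq i j; rewrite big1 => [|k ki]; last first.
    by rewrite (IH k (leq_trans ki im) (ltn_trans ki ij)) mulr0.
  have -> : (i == j) = false by apply/negbTE; rewrite neq_ltn ij.
  by rewrite addr0 => /eqP; rewrite mulf_eq0 (negbTE (Lii i)) => /eqP.
split=> [|i]; first exact/is_trig_mxP.
have := row_eq i i; rewrite eqxx big1 ?addr0// => k ki.
by rewrite M0 ?mulr0.
Qed.

Lemma psd_posdef_reduce n (X Y : 'M[C]_n) : psdmx X -> posdefmx Y ->
  exists F : 'M[C]_n, exists2 d : 'I_n -> R,
    [/\ F \in unitmx, Y = F *m F^t* & F^t* *m X *m F = rdiag_mx d] &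
    forall i, 0 <= d i.
Proof.
move=> pX pY; have SS := mxpowR_sqrt pY.
have pS := mxpowR_posdef (1 / 2) pY.
have uS := posdefmx_unit pS; have /hermsymmxP hS := pS.1.
move: (mxpowR Y (1 / 2)) => S in SS hS uS pS *.
have pN : psdmx (S *m X *m S^t*) by exact: psdmx_congr.
have := fun i => rspec_ge0 i pN.
move: (spectralE pN.1) (spectral_unitarymx (S *m X *m S^t*)).
move: (spectralmx _) (rspec _) => U d NE uU d0.
have uUu := unitarymx_unit uU; have UUs := unitarymxP uU.
(* [U] diagonalises S X S, where [S] is the square root of [Y]; as [U] is unitary, F = S U^* still
   satisfies F F^* = Y. *)
exists (S *m U^t*), d => //.
have UsU : U^t* *m U = 1%:M by rewrite -(invmx_unitary uU) mulVmx.
split; first by rewrite unitmx_mul uS trmxC_unit.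
  by rewrite trmxC_mul trmxCK hS !mulmxA -(mulmxA S) UsU mulmx1.
rewrite trmxC_mul trmxCK hS.
have -> : U *m S *m X *m (S *m U^t*) = U *m (S *m X *m S^t*) *m U^t*.
  by rewrite hS !mulmxA.
by rewrite NE !mulmxA UUs mul1mx -mulmxA UUs mulmx1.
Qed.

Lemma etr_mul_factor n (X F : 'M[C]_n) r : F \in unitmx ->
  etr (X *m (F *m F^t*)) r = etr (F^t* *m X *m F) r.
Proof.
move=> uF; have uFs : F^t* \in unitmx by rewrite trmxC_unit.
by rewrite mulmxA (etr_mulC _ _ uFs) mulmxA.
Qed.

Lemma trace_holder n (X Y Z : 'M[C]_n) (s r t a : R) :
  psdmx X -> posdefmx Y -> posdefmx Z -> 0 < a < 1 -> 0 < r -> 0 < t ->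
  r * (1 - a) = s -> t * a = s ->
  etr (X *m Y) s <= etr (X *m invmx Z) r `^ (1 - a) * etr (Z *m Y) t `^ a.
Proof.
move=> pX pY pZ a01 r0 t0 rs ts; have /andP[a0 a1] := a01.
have [F [d [uF YE XE] d0]] := psd_posdef_reduce pX pY.
have uFs : F^t* \in unitmx by rewrite trmxC_unit.
have pP : posdefmx (F^t* *m Z *m F).
  by have := posdefmx_congr uFs pZ; rewrite trmxCK.
have [L trL PE] := cholesky pP.
have uP := posdefmx_unit pP.
have uL : L \in unitmx by move: uP; rewrite PE unitmx_mul => /andP[].
have uLs : L^t* \in unitmx by rewrite trmxC_unit.
have [trM LM] := trig_mx_inv trL uL (mulmxV uL).
have XY : etr (X *m Y) s = \sum_i d i `^ s.
  by rewrite YE (etr_mul_factor _ _ uF) XE etr_rdiag.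
have ZY : etr (Z *m Y) t = etr (L *m rdiag_mx (fun=> 1) *m L^t*) t.
  by rewrite YE (etr_mul_factor _ _ uF) PE rdiag_mx1 mulmx1.
(* Since P = F^* Z F = L L^*, the inverse of [Z] is G G^* with G = F (L^-1)^*, and G^* X G = L^-1
   diag d (L^-1)^* has the form required by Weyl's theorem. *)
have XZ : etr (X *m invmx Z) r = etr (invmx L *m rdiag_mx d *m (invmx L)^t*) r.
  have uK : F *m (invmx L)^t* \in unitmx.
    by rewrite trmxC_inv unitmx_mul uF unitmx_inv.
  have -> : invmx Z = F *m (invmx L)^t* *m (F *m (invmx L)^t*)^t*.
    apply: mulmx1_invmx; apply: (can_inj (mulmxK uF)).
    rewrite mul1mx trmxC_mul trmxCK.
    have -> : F *m (invmx L)^t* *m (invmx L *m F^t*) *m Z *m F =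
        F *m (invmx L)^t* *m (invmx L *m (F^t* *m Z *m F)) by rewrite !mulmxA.
    by rewrite PE (mulKmx uL) trmxC_inv (mulmxKV uLs).
  by rewrite (etr_mul_factor _ _ uK) trmxC_mul trmxCK -XE !mulmxA.
rewrite XY ZY XZ.
have sq1 (i : 'I_n) : sqnorm (invmx L i i) * sqnorm (L i i) = 1.
  apply: (@complexI R); rewrite rmorphM/= !sqnormE mulrACA -rmorphM.
  by rewrite [invmx L i i * _]mulrC LM rmorph1 mulr1.
apply: (holder_sum_reciprocal a01 rs ts d0 _ _ sq1) => [i|i||].
- exact: sqnorm_ge0.
- exact: sqnorm_ge0.
- exact: weyl_powR.
have := weyl_powR trL (fun=> ler01) t0; apply: le_trans.
by rewrite le_eqVlt; apply/orP; left; apply/eqP/eq_bigr => i _; rewrite mul1r.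
Qed.

End TraceHolder.

(** * Bounds and extremal values *)

Section Variational.
Variable R : realType.
Local Notation C := R[i].
Implicit Types n : nat.

(** G X G and X G G are similar; this replaces Hermitian sandwiches by products, which need not be
    Hermitian. *)
Lemma trpowR_congr n (X G : 'M[C]_n) r : X \is hermsymmx -> posdefmx G ->
  trpowR (G *m X *m G) r = etr (X *m (G *m G)) r.
Proof.
move=> hX pG; have /hermsymmxP hG := pG.1.
have hN : G *m X *m G \is hermsymmx by have := hermsymmx_congr G hX; rewrite hG.
rewrite (trpowR_etr _ hN) [in RHS]mulmxA [RHS](etr_mulC _ _ (posdefmx_unit pG)).
by rewrite mulmxA.
Qed.

Lemma trpowR_sandwich n (K T G : 'M[C]_n) r : T \is hermsymmx -> posdefmx G ->
  trpowR (G *m K^t* *m T *m K *m G) r = etr (K^t* *m T *m K *m (G *m G)) r.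
Proof.
move=> hT pG; have hX : K^t* *m T *m K \is hermsymmx.
  by have := hermsymmx_congr (K^t*) hT; rewrite trmxCK.
by rewrite -(trpowR_congr _ hX pG) !mulmxA.
Qed.

(** With [S] the square root of [Y], both products are similar to the positive definite S Z S or to
    its inverse, where [etr_inv] applies. *)
Lemma etr_mul_inv n (Y Z : 'M[C]_n) r : posdefmx Y -> posdefmx Z ->
  etr (invmx Y *m invmx Z) (- r) = etr (Z *m Y) r.
Proof.
move=> pY pZ; have SS := mxpowR_sqrt pY.
have pS := mxpowR_posdef (1 / 2) pY.
have uS := posdefmx_unit pS; have /hermsymmxP hS := pS.1.
move: (mxpowR Y (1 / 2)) => S in SS hS uS pS *.
have pW : posdefmx (S *m Z *m S) by have := posdefmx_congr uS pZ; rewrite hS.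
have uZ := posdefmx_unit pZ; have uV : invmx S \in unitmx by rewrite unitmx_inv.
have YV : invmx Y = invmx S *m invmx S.
  by apply: mulmx1_invmx; rewrite -SS -mulmxA (mulKmx uS) (mulVmx uS).
have WV : invmx (S *m Z *m S) = invmx S *m invmx Z *m invmx S.
  by apply: mulmx1_invmx; rewrite -!mulmxA (mulKmx uS) (mulKmx uZ) (mulVmx uS).
rewrite YV -mulmxA -(etr_mulC _ _ uV) -WV (etr_inv _ pW) -SS.
by rewrite [Z *m _]mulmxA [RHS](etr_mulC _ _ uS) mulmxA.
Qed.

Lemma etr0 n r : r != 0 -> etr (0 : 'M[C]_n) r = 0.
Proof.
move=> r0; have -> : 0 = rdiag_mx (fun=> 0) :> 'M[C]_n.
  by apply/matrixP => i j; rewrite !mxE mul0rn.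
by rewrite etr_rdiag big1// => i _; rewrite powR0.
Qed.

Lemma etr_mx0 (M : 'M[C]_0) r : etr M r = 0.
Proof. by rewrite (flatmx0 M) -(flatmx0 (rdiag_mx (fun=> 0))) etr_rdiag big_ord0. Qed.

Lemma etr_mul_gt0 n (Y Z : 'M[C]_n.+1) r : posdefmx Y -> posdefmx Z ->
  0 < etr (Z *m Y) r.
Proof.
move=> pY pZ; have [F [d [uF -> _] _]] := psd_posdef_reduce (posdefmx_psd pY) pY.
have uFs : F^t* \in unitmx by rewrite trmxC_unit.
rewrite (etr_mul_factor _ _ uF); apply: etr_gt0.
by have := posdefmx_congr uFs pZ; rewrite trmxCK.
Qed.

(* Only possible for [n = 0]. *)
Lemma etr_mul_eq0 n (Y Z M : 'M[C]_n) r r' : posdefmx Y -> posdefmx Z ->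
  etr (Z *m Y) r = 0 -> etr M r' = 0.
Proof.
case: n => [|n] in Y Z M * => pY pZ; first by move=> _; exact: etr_mx0.
by move=> /eqP; rewrite (gt_eqF (etr_mul_gt0 r pY pZ)).
Qed.

Lemma trace_holder_reverse n (X Y Z : 'M[C]_n) (s q : R) :
  psdmx X -> posdefmx Y -> posdefmx Z -> 0 < s -> q < 0 ->
  etr (X *m invmx Z) (s / (1 - s * q)) `^ (1 - s * q)
    * etr (Z *m Y) (1 / q) `^ (s * q) <= etr (X *m Y) s.
Proof.
move=> pX pY pZ s0 q0; have sq0 : s * q < 0 by rewrite pmulr_rlt0.
have sq1 : 0 < 1 - s * q by lra.
have sq1n : 1 - s * q != 0 by rewrite gt_eqF.
have qn : q != 0 by rewrite lt_eqF.
(* Chosen so that 1 - a = 1/(1 - sq): raising the inequality to the power 1 - sq then isolates the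
   trace of X Y. *)
pose a := - (s * q) / (1 - s * q).
have a01 : 0 < a < 1.
  by rewrite divr_gt0 ?oppr_gt0//= ltr_pdivrMr//; lra.
have t0 : 0 < - (1 / q) by rewrite oppr_gt0 div1r invr_lt0.
have := trace_holder pX (posdefmx_inv pZ) (posdefmx_inv pY) a01 s0 t0.
have e1 : s * (1 - a) = s / (1 - s * q) by rewrite /a; field.
have e2 : - (1 / q) * a = s / (1 - s * q) by rewrite /a; field; apply/andP.
move=> /(_ _ e1 e2); rewrite invmxK (etr_mul_inv _ pY pZ).
have e3 : 1 - a = (1 - s * q)^-1 by rewrite /a; field.
set L := etr (X *m invmx Z) _; set Rr := etr (Z *m Y) _; set P := etr (X *m Y) _ => h.
have L0 : 0 <= L by exact: etr_ge0.
have P0 : 0 <= P by exact: etr_ge0.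
have R0 : 0 <= Rr by exact: etr_ge0.
clearbody L Rr P.
have h' : L `^ (1 - s * q) <= P * Rr `^ (- (s * q)).
  have : L `^ (1 - s * q) <= (P `^ (1 - a) * Rr `^ a) `^ (1 - s * q).
    by rewrite ge0_ler_powR ?nnegrE ?mulr_ge0 ?powR_ge0// ltW.
  rewrite powRM ?powR_ge0// -!powRrM e3 mulVf// powRr1//.
  by rewrite /a divfK.
apply: le_trans (ler_wpM2r (powR_ge0 _ _) h') _.
(* If the right trace is 0, its negative power is 0 by convention and the left side vanishes. *)
move: R0; rewrite le_eqVlt => /predU1P[<-|R0].
  by rewrite [_ `^ (s * q)]powR0 ?lt_eqF// mulr0.
by rewrite -mulrA -powRD ?(gt_eqF R0) ?implybT// addNr powRr0 mulr1.
Qed.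

(** Turns the extremal problem into one about positive vectors: for the [Z] with F^* Z F = diag e,
    all three spectra are explicit. *)
Lemma etr_attain n (X Y : 'M[C]_n) : psdmx X -> posdefmx Y ->
  exists d : 'I_n -> R, [/\ forall i, 0 <= d i,
    X \in unitmx -> forall i, 0 < d i,
    forall s, etr (X *m Y) s = \sum_i d i `^ s &
    forall e : 'I_n -> R, (forall i, 0 < e i) -> exists2 Z, posdefmx Z &
      forall r, etr (X *m invmx Z) r = \sum_i (d i / e i) `^ r
                /\ etr (Z *m Y) r = \sum_i e i `^ r].
Proof.
move=> pX pY; have [F [d [uF YE XE] d0]] := psd_posdef_reduce pX pY.
have uFs : F^t* \in unitmx by rewrite trmxC_unit.
exists d; split=> // [uX i|s|e e0].
- have : rdiag_mx d \in unitmx by rewrite -XE !unitmx_mul uFs uX.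
  rewrite unitmxE det_diag unitfE => /prodf_neq0/(_ i isT); rewrite mxE => di.
  by rewrite lt_neqAle d0 andbT eq_sym; apply: contra di => /eqP->.
- by rewrite YE (etr_mul_factor _ _ uF) XE etr_rdiag.
have uV : (invmx F)^t* \in unitmx by rewrite trmxC_unit unitmx_inv.
pose Z := (invmx F)^t* *m rdiag_mx e *m invmx F.
have pZ : posdefmx Z.
  by have := posdefmx_congr uV (rdiag_mx_posdef e0); rewrite trmxCK.
have ZE : F^t* *m Z *m F = rdiag_mx e.
  by rewrite /Z !mulmxA trmxC_inv (mulmxV uFs) mul1mx (mulmxKV uF).
clearbody Z; exists Z => // r; split; last first.
  by rewrite YE (etr_mul_factor _ _ uF) ZE etr_rdiag.
have -> : invmx Z = F *m rdiag_mx (fun i => (e i)^-1) *m F^t*.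
  apply: mulmx1_invmx; apply: (can_inj (mulmxK uF)).
  have -> : F *m rdiag_mx (fun i => (e i)^-1) *m F^t* *m Z *m F =
      F *m rdiag_mx (fun i => (e i)^-1) *m (F^t* *m Z *m F) by rewrite !mulmxA.
  rewrite mul1mx ZE -mulmxA rdiag_mxM (@eq_rdiag_mx _ _ _ (fun=> 1)) ?rdiag_mx1 ?mulmx1// => i.
  by rewrite mulVf// gt_eqF.
rewrite mulmxA (etr_mulC _ _ uFs) !mulmxA XE rdiag_mxM etr_rdiag.
by [].
Qed.

Lemma etr_sum_attain n (X Y : 'M[C]_n) (s q : R) : psdmx X -> posdefmx Y ->
  0 < s -> q != 0 -> 0 < 1 - s * q ->
  let value Z := (1 - s * q) * etr (X *m invmx Z) (s / (1 - s * q))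
    + s * q * etr (Z *m Y) (1 / q) in
  (X \in unitmx -> exists2 Z, posdefmx Z & value Z = etr (X *m Y) s) /\
  (forall eps, 0 < eps ->
    exists2 Z, posdefmx Z & `|value Z - etr (X *m Y) s| <= eps).
Proof.
move=> pX pY s0 qn sq1 value; have [d [d0 dp XYE attain]] := etr_attain pX pY.
have sqn : s * q != 0 by rewrite mulf_neq0// gt_eqF.
have sn : s != 0 by rewrite gt_eqF.
have sq1n : 1 - s * q != 0 by rewrite gt_eqF.
(* At e = x^(sq) both traces contribute x^s, and the weights 1 - sq and sq add up to 1. *)
have term x : 0 < x -> (1 - s * q) * (x / x `^ (s * q)) `^ (s / (1 - s * q))
    + s * q * (x `^ (s * q)) `^ (1 / q) = x `^ s.
  move=> x0; have -> : x / x `^ (s * q) = x `^ (1 - s * q).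
    by rewrite -powRN -{1}(powRr1 (ltW x0)) -powRD ?(gt_eqF x0) ?implybT.
  rewrite -!powRrM mulrCA divff// mulr1.
  have -> : s * q * (1 / q) = s by field.
  by rewrite -mulrDl subrK mul1r.
split=> [uX|eps eps0].
  have /attain[Z pZ ZE] : forall i, 0 < d i `^ (s * q) by move=> i; rewrite powR_gt0 ?dp.
  exists Z => //; rewrite /value (ZE _).1 (ZE _).2 XYE !mulr_sumr -big_split/=.
  by apply: eq_bigr => i _; rewrite term ?dp.
(* At most [n] vanishing entries contribute |sq| [delta] each; [n.+1] keeps the denominator nonzero
   for [n = 0]. *)
pose delta := eps / (`|s * q| * n.+1%:R).
have delta0 : 0 < delta by rewrite divr_gt0// mulr_gt0 ?normr_gt0.
(* Where d_i = 0 the left term is 0, and the right term e_i^(1/q) equals [delta]. *)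
pose e i := if d i == 0 then delta `^ q else d i `^ (s * q).
have /attain[Z pZ ZE] i : 0 < e i.
  rewrite /e; case: eqVneq => di; rewrite powR_gt0//.
  by rewrite lt_neqAle eq_sym di d0.
exists Z => //; rewrite /value (ZE _).1 (ZE _).2 XYE !mulr_sumr -big_split/=.
rewrite -sumrB; apply: le_trans (ler_norm_sum _ _ _) _.
apply: (@le_trans _ _ (\sum_(i < n) `|s * q| * delta)).
  apply: ler_sum => i _; rewrite /e; case: eqVneq => [->|di].
    rewrite mul0r !powR0 ?mulf_neq0 ?invr_eq0// mulr0 add0r subr0.
    have -> : (delta `^ q) `^ (1 / q) = delta.
      by rewrite -powRrM div1r mulfV// powRr1 ?(ltW delta0).
    by rewrite normrM [`|delta|]ger0_norm ?(ltW delta0).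
  have di0 : 0 < d i by rewrite lt_neqAle eq_sym di d0.
  by rewrite (term _ di0) subrr normr0 mulr_ge0 ?normr_ge0 ?(ltW delta0).
rewrite sumr_const card_ord -mulr_natr /delta.
rewrite [leLHS](_ : _ = eps * (n%:R / n.+1%:R)); last first.
  have a0 : `|s * q| != 0 by rewrite normr_eq0.
  have N0 : n.+1%:R != 0 :> R by rewrite pnatr_eq0.
  by move: n%:R n.+1%:R N0 => m N N0; field; rewrite a0 N0.
by rewrite ger_pMr// ler_pdivrMr// mul1r ler_nat.
Qed.

End Variational.

(** Attainment is asserted for invertible [K], and for products also for [K = 0], because the
    extremum of a singular [K] may only be approached: for [K = 0] and [n > 0] every sum is sq times
    a positive trace, while [Psi] is 0. *)
Theorem corollary3p4 (R : realType) (n : nat) (A B K : 'M[R[i]]_n) (p q s : R)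
    (hA : posdefmx A) (hB : posdefmx B) :
  (0 < s -> 0 < q -> s < 1 / q ->
     (infimums (product_values K p q s A B) (Psi K p q s A B)
      /\ (K \in unitmx \/ K = 0 ->
          is_min (product_values K p q s A B) (Psi K p q s A B)))
     /\
     (infimums (sum_values K p q s A B) (Psi K p q s A B)
      /\ (K \in unitmx ->
          is_min (sum_values K p q s A B) (Psi K p q s A B))))
  /\
  (0 < s -> q < 0 ->
     (supremums (product_values K p q s A B) (Psi K p q s A B)
      /\ (K \in unitmx \/ K = 0 ->
          is_max (product_values K p q s A B) (Psi K p q s A B)))
     /\
     (supremums (sum_values K p q s A B) (Psi K p q s A B)
      /\ (K \in unitmx ->
          is_max (sum_values K p q s A B) (Psi K p q s A B)))).
Proof.
have pAp := mxpowR_posdef p hA; have pY := mxpowR_posdef q hB.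
pose X := K^t* *m mxpowR A p *m K.
have pX : psdmx X.
  by have := psdmx_congr (K^t*) (posdefmx_psd pAp); rewrite trmxCK.
have uX : K \in unitmx -> X \in unitmx.
  by move=> uK; rewrite /X 2!unitmx_mul trmxC_unit uK (posdefmx_unit pAp).
have PsiE : Psi K p q s A B = etr (X *m mxpowR B q) s.
  rewrite /Psi (trpowR_sandwich _ _ pAp.1 (mxpowR_posdef (q / 2) hB)).
  by rewrite (mxpowR_half q hB).
have leftE Z : posdefmx Z ->
    trace_left K p q s A Z = etr (X *m invmx Z) (s / (1 - s * q)).
  move=> pZ; rewrite /trace_left.
  rewrite (trpowR_sandwich _ _ pAp.1 (mxpowR_posdef (- (1 / 2)) pZ)).
  by rewrite (mxpowRD _ _ pZ) -opprD -splitr (mxpowRN1 pZ).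
have rightE Z : posdefmx Z -> trace_right q B Z = etr (Z *m mxpowR B q) (1 / q).
  move=> pZ; rewrite /trace_right (trpowR_congr _ pY.1 (mxpowR_posdef (1 / 2) pZ)).
  by rewrite (mxpowR_sqrt pZ) (etr_mulC _ _ (posdefmx_unit pZ)).
have X0 : K = 0 -> X = 0 by move=> K0; rewrite /X K0 mulmx0.
rewrite /product_values /sum_values PsiE.
move: (mxpowR B q) pY X pX uX X0 leftE rightE {PsiE} => Y pY X pX uX X0 leftE rightE.
set P := etr (X *m Y) s.
pose lv Z := etr (X *m invmx Z) (s / (1 - s * q)).
pose rv Z := etr (Z *m Y) (1 / q).
pose prodv Z := lv Z `^ (1 - s * q) * rv Z `^ (s * q).
pose sumv Z := (1 - s * q) * lv Z + s * q * rv Z.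
have prodE Z : posdefmx Z -> trace_left K p q s A Z `^ (1 - s * q)
    * trace_right q B Z `^ (s * q) = prodv Z.
  by move=> pZ; rewrite leftE// rightE.
have sumE Z : posdefmx Z -> (1 - s * q) * trace_left K p q s A Z
    + s * q * trace_right q B Z = sumv Z.
  by move=> pZ; rewrite leftE// rightE.
have lv0 Z : 0 <= lv Z by exact: etr_ge0.
have rv0 Z : 0 <= rv Z by exact: etr_ge0.
(* For [K = 0] the left factor vanishes at every [Z], so any positive definite witness serves; [Y]
   is at hand. *)
have prod0 : 0 < s -> q != 0 -> 0 < 1 - s * q -> K = 0 ->
    P = trace_left K p q s A Y `^ (1 - s * q) * trace_right q B Y `^ (s * q).
  move=> s0 qn sq1 /X0 X00; rewrite prodE// /P /prodv /lv X00 !mul0mx.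
  by rewrite !etr0 ?mulf_neq0 ?invr_eq0 ?(gt_eqF s0) ?(gt_eqF sq1)// powR0 ?mul0r ?gt_eqF.
split=> [s0 q0 sq|s0 q0].
  have sq0 : 0 < s * q by rewrite mulr_gt0.
  have sq1 : 0 < 1 - s * q by rewrite subr_gt0 -ltr_pdivlMr.
  have qn : q != 0 by rewrite gt_eqF.
  have a01 : 0 < s * q < 1 by rewrite sq0 -subr_gt0.
  have e1 : s / (1 - s * q) * (1 - s * q) = s by rewrite divfK ?gt_eqF.
  have e2 : 1 / q * (s * q) = s by rewrite div1r mulrCA mulVf// mulr1.
  have r0 : 0 < s / (1 - s * q) by rewrite divr_gt0.
  have t0 : 0 < 1 / q by rewrite divr_gt0.
  have hP Z : posdefmx Z -> P <= prodv Z.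
    by move=> pZ; exact: trace_holder.
  have hY Z : prodv Z <= sumv Z.
    exact: young_powR.
  have [exact approx] := etr_sum_attain pX pY s0 qn sq1.
  (* Serves products and sums alike: a value lying below the sum at the same [Z] is at most P + eps
     whenever that sum is within eps of [P]. *)
  have near (E : R -> Prop) (v : 'M[R[i]]_n -> R) :
      (forall Z, posdefmx Z -> E (v Z) /\ v Z <= sumv Z) ->
      ubound (lbound E) P.
    move=> hE y hy; apply/ler_addgt0Pr => eps /approx[Z pZ hZ].
    have [/hy yv vs] := hE Z pZ; apply: le_trans yv (le_trans vs _).
    by rewrite -lerBlDl; apply: le_trans hZ; exact: ler_norm.
  split; split.
  - split=> [_ [Z pZ ->]|]; first by rewrite prodE ?hP.
    by apply: (@near _ prodv) => Z pZ; split; [exists Z => //; exact/esym/prodE|exact: hY].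
  - move=> hK; split=> [|_ [Z pZ ->]]; last by rewrite prodE ?hP.
    case: hK => [/uX/exact[Z pZ ZE]|K0]; last by exists Y => //; exact: prod0.
    (* The product lies between [P] and the sum, which equals [P] at this [Z]. *)
    exists Z => //; rewrite prodE//; apply/le_anti.
    by rewrite hP//= (le_trans (hY Z))// [leLHS]ZE.
  - split=> [_ [Z pZ ->]|]; first by rewrite sumE// (le_trans (hP _ pZ)).
    by apply: (@near _ sumv) => Z pZ; split; [exists Z => //; exact/esym/sumE|].
  - move=> /uX/exact[Z pZ ZE]; split=> [|_ [Z' pZ' ->]].
      by exists Z => //; rewrite sumE// [RHS]ZE.
    by rewrite sumE// (le_trans (hP _ pZ')).
have sq0 : s * q < 0 by rewrite pmulr_rlt0.
have sq1 : 0 < 1 - s * q by rewrite subr_gt0 (lt_trans sq0).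
have qn : q != 0 by rewrite lt_eqF.
have hP Z : posdefmx Z -> prodv Z <= P.
  by move=> pZ; exact: trace_holder_reverse.
(* The side condition of the reverse Young inequality holds because the right trace vanishes only
   for [n = 0], where all traces do. *)
have hY Z : posdefmx Z ->
    sumv Z <= prodv Z.
  by move=> pZ; apply: young_powR_reverse => // rZ; exact: (etr_mul_eq0 _ _ pY pZ rZ).
have [exact approx] := etr_sum_attain pX pY s0 qn sq1.
(* The mirror image: values above the sums, which themselves come within any eps of [P]. *)
have near (E : R -> Prop) (v : 'M[R[i]]_n -> R) :
    (forall Z, posdefmx Z -> E (v Z) /\ sumv Z <= v Z) ->
    lbound (ubound E) P.
  move=> hE y hy; apply/ler_addgt0Pr => eps /approx[Z pZ hZ].
  have [/hy yv vs] := hE Z pZ; rewrite -lerBlDr.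
  apply: le_trans yv; apply: le_trans vs; rewrite lerBlDr -lerBlDl.
  by apply: le_trans hZ; rewrite distrC; exact: ler_norm.
split; split.
- split=> [_ [Z pZ ->]|]; first by rewrite prodE ?hP.
  by apply: (@near _ prodv) => Z pZ; split; [exists Z => //; exact/esym/prodE|exact: hY].
- move=> hK; split=> [|_ [Z pZ ->]]; last by rewrite prodE ?hP.
  case: hK => [/uX/exact[Z pZ ZE]|K0]; last by exists Y => //; exact: prod0.
  exists Z => //; rewrite prodE//; apply/le_anti.
  by rewrite hP//= andbT (le_trans _ (hY Z pZ))// [leRHS]ZE.
- split=> [_ [Z pZ ->]|]; first by rewrite sumE// (le_trans (hY _ pZ)) ?hP.
  by apply: (@near _ sumv) => Z pZ; split; [exists Z => //; exact/esym/sumE|].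
- move=> /uX/exact[Z pZ ZE]; split=> [|_ [Z' pZ' ->]].
    by exists Z => //; rewrite sumE// [RHS]ZE.
  by rewrite sumE// (le_trans (hY _ pZ')) ?hP.
Qed.
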